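(* Let $M$ be a locally compact separable metrizable topological space, $\mu$ a $\sigma$-finite Borel measure on $M$ and $X$ a Hunt process on $(M,\mathscr{B}(M))$. Let $I\in\mathscr{B}([0,\infty))$, let $V,W\in\mathscr{B}(M)$ and let $H=H_t(x,y):I\times V\times W\to[0,\infty]$ be Borel measurable. Let $U$ be a non-empty open subset of $M$. Then the following two conditions are equivalent: (1) For any $(t,x)\in I\times V$ and any $A\in\mathscr{B}(W)$, $\mathcal{P}^U_t(x,A)\le\int_AH_t(x,y)\,d\mu(y)$. (2) There exists a Borel measurable function $p^U=p^U_t(x,y):I\times V\times W\to[0,\infty]$ such that for any $(t,x)\in I\times V$, $$\mathcal{P}^U_t(x,A)=\int_Ap^U_t(x,y)\,d\mu(y)\quad\text{for any }A\in\mathscr{B}(W),\qquad p^U_t(x,y)\le H_t(x,y)\quad\text{for any }y\in W.$$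
   Context: $\mathscr{B}(E)$ is the Borel $\sigma$-field of $E$; $\inf\emptyset:=\infty$. $M_\Delta=M\cup\{\Delta\}$ is the one-point compactification of $M$. A Hunt process $X=(\Omega,\mathscr{M},\{X_t\}_{t\in[0,\infty]},\{\mathbb{P}_x\}_{x\in M_\Delta})$ on $(M,\mathscr{B}(M))$ is a normal Markov process on $(M,\mathscr{B}(M))$ ($\mathbb{P}_x[X_0=x]=1$, $x\mapsto\mathbb{P}_x[X_t\in A]$ Borel for $A\in\mathscr{B}(M)$) with cemetery $\Delta$ ($X_t(\omega)=\Delta$ for all $t\in[\zeta(\omega),\infty]$, where $\zeta(\omega):=\inf\{t\in[0,\infty)\mid X_t(\omega)=\Delta\}$ is the life time), with shift operators $\theta_t:\Omega\to\Omega$, $X_s\circ\theta_t=X_{s+t}$, whose paths $[0,\infty)\ni t\mapsto X_t(\omega)\in M_\Delta$ are all right-continuous with left limits in $M_\Delta$ on $(0,\infty)$, whose minimum completed admissible filtration is right-continuous, and which is strong Markov and quasi-left-continuous with respect to that filtration. $\tau_U:=\inf\{t\in[0,\infty)\mid X_t\in M_\Delta\setminus U\}$ and $\mathcal{P}^U_t(x,A):=\mathbb{P}_x[X_t\in A,\,t<\tau_U]$ for $t\in[0,\infty)$, $x\in M$, $A\in\mathscr{B}(M)$. It is part of the general theory that $(t,x)\mapsto\mathcal{P}^U_t(x,A)$ is Borel measurable on $[0,\infty)\times M$ for each $A\in\mathscr{B}(M)$. *)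

(* Defs.v *)
From HB Require Import structures.
From mathcomp Require Import all_boot all_order all_algebra.
From mathcomp Require Import all_classical all_reals all_analysis.
From mathcomp Require Import measurable_realfun.

Set Implicit Arguments.
Unset Strict Implicit.
Unset Printing Implicit Defensive.

Import Order.TTheory GRing.Theory Num.Theory.
Import numFieldNormedType.Exports.

Local Open Scope classical_set_scope.
Local Open Scope ring_scope.
Local Open Scope ereal_scope.

Definition metrizable (R : realType) (T : topologicalType) : Prop :=
  exists d : T -> T -> R,
    [/\ forall x y, d x y = 0%R <-> x = y,
        forall x y, d x y = d y x,
        forall x y z, (d x z <= d x y + d y z)%R &
        forall x, nbhs x =
          filter_from [set e : R | (0 < e)%R]
                      (fun e => [set y | (d x y < e)%R]) ].

Definition separable (T : topologicalType) : Prop :=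
  exists2 S : set T, countable S & dense S.

Notation borel T := (g_sigma_algebraType (@open T)).

(* When M is compact, the library's topology makes the added point isolated,
   as usual. *)
Notation compactification M := (one_point_compactification M).

Definition Delta {M : ptopologicalType} : compactification M := None.

(* The time set [0, +oo] is represented by the nonnegative elements of \bar R:
   values at negative times are junk and are never used. *)
Record process (R : realType) (M : ptopologicalType) := Process {
  sample_display : measure_display ;
  sample : measurableType sample_display ;
  coord : \bar R -> sample -> compactification M ;
  shift : \bar R -> sample -> sample ;
  law : compactification M -> probability sample R }.

Arguments coord {R M} p t w.
Arguments shift {R M} p t w.

Section process_theory.
Context (R : realType) (M : ptopologicalType).
Variable X : process R M.

Local Notation Omega := (sample X).
Local Notation MD := (compactification M).

Definition lifetime (w : Omega) : \bar R :=
  ereal_inf [set t%:E | t in [set t : R | (0 <= t)%R /\ coord X t%:E w = Delta]].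

Definition exit_time (U : set M) (w : Omega) : \bar R :=
  ereal_inf [set t%:E | t in
    [set t : R | (0 <= t)%R /\ (~` (Some @` U)) (coord X t%:E w)]].

Definition coord_events (t : \bar R) : set (set Omega) :=
  [set E | exists s (A : set (borel MD)),
     [/\ 0 <= s <= t, measurable A & E = coord X s @^-1` A]].

Definition natural_filtration (t : \bar R) : set (set Omega) :=
  <<s coord_events t >>.

(* The sample space equipped with the sigma-algebra generated by the whole
   process, [natural_filtration +oo]. *)
Local Notation Omega0 := (g_sigma_algebraType (coord_events +oo)).

(* The measure P_nu on [natural_filtration +oo]. *)
Definition init_law (nu : probability (borel MD) R) (E : set Omega) : \bar R :=
  \int[nu]_x law X x E.

(* The completion of [natural_filtration t] in the P_nu-completion of
   [natural_filtration +oo]. *)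
Definition completed_at (nu : probability (borel MD) R) (t : \bar R) :
    set (set Omega) :=
  [set E | exists E0 N : set Omega,
     [/\ natural_filtration t E0, natural_filtration +oo N,
         init_law nu N = 0 &
         (E `\` E0) `|` (E0 `\` E) `<=` N]].

(* The minimum completed admissible filtration. *)
Definition filtration (t : \bar R) : set (set Omega) :=
  \bigcap_(nu in [set: probability (borel MD) R]) completed_at nu t.

(* The extension of P_nu to its completion: on completed sets, the outer
   measure coincides with the completed measure. *)
Definition init_law_completed (nu : probability (borel MD) R) :
    set (g_sigma_algebraType (filtration +oo)) -> \bar R :=
  @mu_ext _ Omega0 R (init_law nu).

Definition stopping_time (sigma : Omega -> \bar R) : Prop :=
  (forall w, 0 <= sigma w) /\
  forall t : R, (0 <= t)%R -> filtration t%:E [set w | sigma w <= t%:E].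

Definition stopped_filtration (sigma : Omega -> \bar R) : set (set Omega) :=
  [set E | filtration +oo E /\
    forall t : R, (0 <= t)%R -> filtration t%:E (E `&` [set w | sigma w <= t%:E])].

Definition simple_markov : Prop :=
  forall (x : M) (t s : R) (A : set (borel M)) (E : set Omega),
    (0 <= t)%R -> (0 <= s)%R -> measurable A -> natural_filtration t%:E E ->
    law X (Some x) (E `&` coord X (t + s)%:E @^-1` (Some @` A)) =
    \int[law X (Some x)]_(w in E)
       law X (coord X t%:E w) (coord X s%:E @^-1` (Some @` A)).

Definition strong_markov : Prop :=
  forall (nu : probability (borel MD) R) (sigma : Omega -> \bar R) (s : R)
         (A : set (borel MD)) (E : set Omega),
    stopping_time sigma -> (0 <= s)%R -> measurable A ->
    stopped_filtration sigma E ->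
    init_law_completed nu (E `&` [set w | A (coord X (sigma w + s%:E) w)]) =
    \int[init_law_completed nu]_(w in E)
       law X (coord X (sigma w) w) (coord X s%:E @^-1` A).

Definition quasi_left_continuous : Prop :=
  forall (nu : probability (borel MD) R) (sigma_ : nat -> Omega -> \bar R)
         (sigma : Omega -> \bar R),
    (forall n, stopping_time (sigma_ n)) ->
    (forall w, nondecreasing_seq (sigma_^~ w)) ->
    (forall w, sigma_ n w @[n --> \oo] --> sigma w) ->
    exists N : set Omega,
      [/\ natural_filtration +oo N, init_law nu N = 0 &
          forall w, ~ N w -> sigma w < +oo ->
            coord X (sigma_ n w) w @[n --> \oo] --> coord X (sigma w) w].

Record is_hunt : Prop := IsHunt {
  coord_measurable : forall t, 0 <= t ->
    measurable_fun [set: Omega] (coord X t : Omega -> borel MD) ;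
  law_normal : forall x : MD, law X x (coord X 0 @^-1` [set x]) = 1 ;
  law_measurable : forall (t : R) (A : set (borel M)),
    (0 <= t)%R -> measurable A ->
    measurable_fun [set: borel M]
      (fun x => law X (Some x) (coord X t%:E @^-1` (Some @` A))) ;
  law_markov : simple_markov ;
  coord_cemetery : forall w t, lifetime w <= t -> coord X t w = Delta ;
  coord_shift : forall s t w, 0 <= s -> 0 <= t ->
    coord X s (shift X t w) = coord X (s + t) w ;
  coord_right_continuous : forall w (t : R), (0 <= t)%R ->
    coord X s%:E w @[s --> t^'+] --> coord X t%:E w ;
  coord_left_limits : forall w (t : R), (0 < t)%R ->
    exists l : MD, coord X s%:E w @[s --> t^'-] --> l ;
  filtration_right_continuous : forall t : R, (0 <= t)%R ->
    \bigcap_(s in [set s : R | (t < s)%R]) filtration s%:E = filtration t%:E ;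
  law_strong_markov : strong_markov ;
  law_quasi_left_continuous : quasi_left_continuous }.

(* The event {X_t \in A, t < tau_U} belongs to [filtration +oo] but not in
   general to the sigma-algebra carried by the sample space; its probability
   is that given by the completion of P_x, which the outer measure computes. *)
Definition killed_kernel (U : set M) (t : R) (x : M) (A : set M) : \bar R :=
  mu_ext (law X (Some x))
    [set w | (Some @` A) (coord X t%:E w) /\ t%:E < exit_time U w].

End process_theory.

Record hunt_process (R : realType) (M : ptopologicalType) := HuntProcess {
  hunt_process_data :> process R M ;
  hunt_process_axioms : is_hunt hunt_process_data }.

(* Main.v *)
(* Only (1) => (2) has content. Under (1) the kernel (t, x) |-> P^U_t(x, - /\ W)
   is dominated by mu, so each of its measures has a density; what is needed is
   a jointly Borel one, below H.

   The kernel is Borel in (t, x). The simple Markov property and a pi-lambda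
   argument on cylinders make x |-> P_x(E) Borel for E in the sigma-algebra
   generated by the paths. Exhausting U by compacts K_n, quasi-left-continuity
   shows that tau_U is a.s. the supremum of the hitting times of the open sets
   complementary to the K_n; unlike tau_U, these are measurable for the
   uncompleted sigma-algebra. By right-continuity {X_t in A, t < sup} is
   jointly measurable in (t, w), and its sections have Borel probability.

   A joint density of a kernel Q_z << mu on a countably generated space: on a
   set of finite measure, pick in a countable generating algebra, measurably in
   z, sets nearly maximizing Q_z - q mu; their limsup is, up to null sets, a Hahn
   set, i.e. separates {f_z > q} from {f_z < q} for the density f_z. The density
   is recovered from these sets for rational q.

   The minimum of this density with H is still a density: split A into
   {p <= H} and {p > H}, and use (1) on the second piece. *)

Require Import Defs.
From HB Require Import structures.
From mathcomp Require Import all_boot all_order all_algebra.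
From mathcomp Require Import all_classical all_reals all_analysis.
From mathcomp Require Import measurable_realfun.
From mathcomp Require Import lra.

Set Implicit Arguments.
Unset Strict Implicit.
Unset Printing Implicit Defensive.

Import Order.TTheory GRing.Theory Num.Theory.
Import numFieldNormedType.Exports.

Local Open Scope classical_set_scope.
Local Open Scope ring_scope.
Local Open Scope ereal_scope.

(* Otherwise [coord] is the coordinate function of [vector]. *)
Local Notation coord := Defs.coord.

(** * Jointly measurable densities of kernels *)

Section generated_algebra.

(** Boolean expressions in the indices of a sequence of sets. They form a countable type, so
    interpreting them enumerates the algebra that the sequence generates. *)
Inductive set_expr := Gen of nat | Neg of set_expr | Cup of set_expr & set_expr.

Fixpoint set_expr_code (b : set_expr) : GenTree.tree nat :=
  match b with
  | Gen n => GenTree.Leaf n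
  | Neg b => GenTree.Node 0 [:: set_expr_code b]
  | Cup b c => GenTree.Node 1 [:: set_expr_code b; set_expr_code c]
  end.

Fixpoint set_expr_decode (t : GenTree.tree nat) : option set_expr :=
  match t with
  | GenTree.Leaf n => Some (Gen n)
  | GenTree.Node 0 [:: b] => omap Neg (set_expr_decode b)
  | GenTree.Node 1 [:: b; c] =>
    if (set_expr_decode b, set_expr_decode c) is (Some b', Some c')
    then Some (Cup b' c') else None
  | _ => None
  end.

Lemma set_expr_codeK : pcancel set_expr_code set_expr_decode.
Proof. by elim=> //= [b ->|b -> c ->]. Qed.

HB.instance Definition _ := Countable.copy set_expr (pcan_type set_expr_codeK).

Context {T : Type}.
Variable G : (set T)^nat.

Fixpoint set_interp (b : set_expr) : set T :=
  match b with
  | Gen n => G n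
  | Neg b => ~` set_interp b
  | Cup b c => set_interp b `|` set_interp c
  end.

Definition generated_algebra (n : nat) : set T :=
  if unpickle n is Some b then set_interp b else set0.

Lemma generated_algebraE b : generated_algebra (pickle b) = set_interp b.
Proof. by rewrite /generated_algebra pickleK. Qed.

End generated_algebra.

Lemma measurable_generated_algebra d (T : measurableType d) (G : (set T)^nat) n :
  (forall n, measurable (G n)) -> measurable (generated_algebra G n).
Proof.
move=> mG; rewrite /generated_algebra; case: (unpickle n) => [b|//].
elim: b => //= [b mb|b mb c mc]; first exact: measurableC.
exact: measurableU.
Qed.

(** * Approximation of measurable sets by a countable generating algebra *)

Section approximation.
Context d (T : measurableType d) (R : realType).
Variables (m1 m2 : {finite_measure set T -> \bar R}) (G : (set T)^nat).
Hypothesis genG : @measurable _ T = <<s range G >>.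

Let mG n : measurable (G n).
Proof. by rewrite genG; apply: sub_sigma_algebra; exists n. Qed.

Let A := set_interp G.

Let mA b : measurable (A b).
Proof.
by rewrite /A -generated_algebraE; exact: measurable_generated_algebra.
Qed.

Let close (C : set T) (e : R) b :=
  m1 (C `\` A b `|` A b `\` C) < e%:E /\ m2 (C `\` A b `|` A b `\` C) < e%:E.

(** One expression has to serve for both measures, because the signed measure [Q z - q m] studied
    later involves the two. This class turns out to be a sigma-algebra. *)
Let approx (C : set T) :=
  measurable C /\ forall e : R, (0 < e)%R -> exists b, close C e b.

Let mdiff C b : measurable C -> measurable (C `\` A b `|` A b `\` C).
Proof. by move=> mC; apply: measurableU; apply: measurableD. Qed.

Let approxC C : approx C -> approx (~` C).
Proof.
move=> [mC aC]; split; first exact: measurableC.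
move=> e e0; have [b bC] := aC e e0; exists (Neg b); rewrite /close.
suff -> : ~` C `\` A (Neg b) `|` A (Neg b) `\` ~` C =
          C `\` A b `|` A b `\` C by [].
rewrite /A /= setDE setCK setDE setCK setUC; congr (_ `|` _).
  by rewrite setIC -setDE.
by rewrite setIC -setDE.
Qed.

Let approxU C D : approx C -> approx D -> approx (C `|` D).
Proof.
move=> [mC aC] [mD aD]; split; first exact: measurableU.
move=> e e0; have e20 : (0 < e / 2)%R by rewrite divr_gt0.
have [b [bC1 bC2]] := aC _ e20; have [c [cD1 cD2]] := aD _ e20.
exists (Cup b c); rewrite /close.
set S := (C `|` D) `\` A (Cup b c) `|` A (Cup b c) `\` (C `|` D).
have SE : S `<=` (C `\` A b `|` A b `\` C) `|` (D `\` A c `|` A c `\` D).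
  rewrite /S /A /= => x [[[Cx|Dx] /not_orP[nb nc]]|[[bx|cx] /not_orP[nC nD]]].
  - by left; left.
  - by right; left.
  - by left; right.
  - by right; right.
have mS : measurable S by apply: mdiff; exact: measurableU.
suff H (m : {finite_measure set T -> \bar R}) :
  m (C `\` A b `|` A b `\` C) < (e / 2)%:E ->
  m (D `\` A c `|` A c `\` D) < (e / 2)%:E -> m S < e%:E by split; apply: H.
move=> h1 h2; apply: (@le_lt_trans _ _
  (m ((C `\` A b `|` A b `\` C) `|` (D `\` A c `|` A c `\` D)))).
  by apply: le_measure; rewrite ?inE//; apply: measurableU; apply: mdiff.
apply: (le_lt_trans (measureU2 _ _ _)); try exact: mdiff.
by rewrite [e]splitr EFinD lteD.
Qed.

Let approx0 : approx set0.
Proof.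
(* There is no constant expression: the empty set is written as the complement of [G 0] united with
   its own complement. *)
split=> // e e0; exists (Neg (Cup (Gen 0) (Neg (Gen 0)))); rewrite /close.
by rewrite /A /= setUv setCT set0D setU0 !measure0 !lte_fin.
Qed.

Let approx_bigcup (F : (set T)^nat) :
  (forall n, approx (F n)) -> approx (\bigcup_n F n).
Proof.
move=> aF; pose S n := \big[setU/set0]_(i < n) F i.
have aS n : approx (S n).
  by rewrite /S; elim/big_ind : _ => // B C; exact: approxU.
have mF n : measurable (F n) by case: (aF n).
have mUF : measurable (\bigcup_n F n) by exact: bigcup_measurable.
split => // e e0; have e20 : (0 < e / 2)%R by rewrite divr_gt0.
have mD n : measurable (\bigcup_n F n `\` S n).
  by apply: measurableD => //; case: (aS n).
(* Continuity from above, as [m] is finite: a finite union replaces the countable one at a cost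
   below [e / 2]. *)
have tail (m : {finite_measure set T -> \bar R}) :
  \forall n \near \oo, m (\bigcup_n F n `\` S n) < (e / 2)%:E.
  have : m \o (fun n => \bigcup_n F n `\` S n) @ \oo -->
      m (\bigcap_n (\bigcup_n F n `\` S n)).
    apply: nonincreasing_cvg_mu => //.
    - by rewrite ltey_eq fin_num_measure.
    - exact: bigcapT_measurable.
    - move=> n p np; apply/subsetPset; apply: setDS.
      exact: subset_bigsetU.
  rewrite (_ : \bigcap_n _ = set0); last first.
    apply/seteqP; split=> // x Hx; have [[n _ Fnx] _] := Hx 0%N I.
    have [_] := Hx n.+1 I; apply; rewrite /S.
    by rewrite big_ord_recr /=; right.
  rewrite measure0 => /fine_cvgP[_] /cvgrPdist_lt/(_ _ e20).
  apply: filterS => n; rewrite /= sub0r normrN ger0_norm ?fine_ge0//.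
  by rewrite -lte_fin fineK// fin_num_measure.
have [n [t1 t2]] : exists n, m1 (\bigcup_n F n `\` S n) < (e / 2)%:E /\
    m2 (\bigcup_n F n `\` S n) < (e / 2)%:E.
  near \oo => n; exists n; split; near: n; exact: tail.
have [mS /(_ _ e20)[b [b1 b2]]] := aS n; exists b.
suff H (m : {finite_measure set T -> \bar R}) :
  m (\bigcup_n F n `\` S n) < (e / 2)%:E ->
  m (S n `\` A b `|` A b `\` S n) < (e / 2)%:E ->
  m (\bigcup_n F n `\` A b `|` A b `\` \bigcup_n F n) < e%:E.
  by split; apply: H.
move=> h1 h2; apply: (@le_lt_trans _ _
  (m ((\bigcup_n F n `\` S n) `|` (S n `\` A b `|` A b `\` S n)))).
  apply: le_measure; rewrite ?inE//; first exact: mdiff.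
    by apply: measurableU => //; exact: mdiff.
  move=> x [[Fx nAx]|[Ax nFx]].
    by have [Sx|nSx] := pselect (S n x); [right; left|left].
  right; right; split=> //; apply: contra_not nFx; rewrite /S.
  by rewrite -bigcup_mkord => -[k _ Fkx]; exists k.
apply: (le_lt_trans (measureU2 _ _ _)) => //; first exact: mdiff.
by rewrite [e]splitr EFinD lteD.
Unshelve. all: by end_near. Qed.

Lemma generated_algebra_dense (C : set T) (e : R) :
  measurable C -> (0 < e)%R ->
  exists n,
    m1 (C `\` generated_algebra G n `|` generated_algebra G n `\` C) < e%:E /\
    m2 (C `\` generated_algebra G n `|` generated_algebra G n `\` C) < e%:E.
Proof.
move=> mC e0; suff : approx C.
  move=> [_ /(_ _ e0)[b [b1 b2]]]; exists (pickle b).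
  by rewrite generated_algebraE.
move: mC; rewrite genG => /(_ approx); apply; split.
  split; [exact: approx0|by move=> B /approxC; rewrite setTD|exact: approx_bigcup].
move=> _ [n _ <-]; split=> // r r0; exists (Gen n); rewrite /close /A /=.
by rewrite setDv setU0 !measure0 !lte_fin.
Qed.

End approximation.

(** * Hahn sets depending measurably on a parameter *)

Section level_set.
Context d d' (Z : measurableType d) (T : measurableType d') (R : realType).
Variables (Q : Z -> {finite_measure set T -> \bar R}).
Variables (m : {finite_measure set T -> \bar R}) (G : (set T)^nat).
Hypothesis genG : @measurable _ T = <<s range G >>.
Hypothesis mQ : forall B, measurable B -> measurable_fun [set: Z] (fun z => Q z B).
Variable q : R.

Let A := generated_algebra G.

Let mA n : measurable (A n).
Proof.
apply: measurable_generated_algebra => k; rewrite genG.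
by apply: sub_sigma_algebra; exists k.
Qed.

Let nu z B : R := (fine (Q z B) - q * fine (m B))%R.

Let eps n : R := (1 / (2 ^ n.+1)%:R)%R.

Let eps_gt0 n : (0 < eps n)%R.
Proof. by rewrite divr_gt0// ltr0n expn_gt0. Qed.

Let nuU z B C : measurable B -> measurable C -> [disjoint B & C] ->
  nu z (B `|` C) = (nu z B + nu z C)%R.
Proof.
move=> mB mC /disj_setPS BC0; rewrite /nu !measureU//.
  by rewrite !fineD ?fin_num_measure//; lra.
all: by apply/seteqP; split => // x /BC0.
Qed.

Let le_fine_measure (p : {finite_measure set T -> \bar R}) B C :
  measurable B -> measurable C -> B `<=` C -> (fine (p B) <= fine (p C))%R.
Proof.
move=> mB mC BC; rewrite fine_le ?fin_num_measure//.
by apply: le_measure; rewrite ?inE.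
Qed.

(** Replacing [B] by [C] changes a finite measure by at most the measure of the symmetric
    difference. *)
Let nu_perturb z B C : measurable B -> measurable C ->
  (nu z B <= nu z C + fine (Q z (B `\` C `|` C `\` B)) +
             `|q| * fine (m (B `\` C `|` C `\` B)))%R.
Proof.
move=> mB mC; set D := B `\` C `|` C `\` B.
have mD : measurable D by apply: measurableU; exact: measurableD.
have dist (p : {finite_measure set T -> \bar R}) :
    (fine (p B) - fine (p C) <= fine (p D))%R /\
    (fine (p C) - fine (p B) <= fine (p D))%R.
  by split; rewrite lerBlDr -fineD ?fin_num_measure// fine_le//
    ?fin_numD ?fin_num_measure//; (apply: le_trans;
    [|apply: measureU2 => //]); apply: le_measure; rewrite ?inE//;
    (try exact: measurableU); move=> x Bx;
    [have [Cx|nCx] := pselect (C x)|have [Cx|nCx] := pselect (B x)];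
    [right|left; left|right|left; right].
have [h1 _] := dist (Q z); have [h2 h3] := dist m.
suff : (- q * (fine (m B) - fine (m C)) <= `|q| * fine (m D))%R.
  by rewrite /nu; move: h1; lra.
apply: (le_trans (ler_norm _)); rewrite normrM normrN ler_wpM2l//.
by rewrite ler_norml h2 andbT; move: h3; lra.
Qed.

(** The parameters for which [A j] maximizes [nu z] over the algebra up to [eps n]. Comparing with
    countably many sets only makes this measurable in [z]. *)
Let near_optimal n j : set Z :=
  \bigcap_i [set z | (nu z (A i) <= nu z (A j) + eps n)%R].

Let measurable_near_optimal n j : measurable (near_optimal n j).
Proof.
have mnu i : measurable_fun [set: Z] (fun z => nu z (A i)).
  apply: measurable_funB => //; apply: measurableT_comp => //.
  exact: mQ.
apply: bigcapT_measurable => i; rewrite -[X in measurable X]setTI.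
have -> : [set z | (nu z (A i) <= nu z (A j) + eps n)%R] =
  (fun z => (nu z (A i) <= nu z (A j) + eps n)%R) @^-1` [set true].
  by apply/seteqP; split.
by apply: measurable_fun_ler => //; exact: measurable_funD.
Qed.

Let near_optimal_exists n z : exists j, near_optimal n j z.
Proof.
pose S := range (fun i => nu z (A i)).
have supS : has_sup S.
  split; first by exists (nu z (A 0%N)); exists 0%N.
  exists (fine (Q z setT) + `|q| * fine (m setT))%R => _ [i _ <-].
  have := nu_perturb z (mA i) (@measurable0 _ T).
  rewrite !setD0 set0D setU0 {2}/nu !measure0 fine0 mulr0 subr0 add0r.
  move/le_trans; apply; rewrite lerD ?ler_wpM2l//; exact: le_fine_measure.
have [_ [j _ <-] hj] := sup_adherent (eps_gt0 n) supS.
exists j => i _ /=; rewrite -lerBlDr; apply: le_trans (ltW hj).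
by rewrite lerB//; apply: sup_upper_bound => //; exists i.
Qed.

(** The parameters whose first near-optimal index is [j]: a measurable choice of an index for each
    [z]. *)
Let sel n j := near_optimal n j `\` \bigcup_(i < j) near_optimal n i.

Let measurable_sel n j : measurable (sel n j).
Proof.
apply: measurableD => //; apply: bigcup_measurable => i _.
exact: measurable_near_optimal.
Qed.

Let sel_exists n z : exists j, sel n j z.
Proof.
have [j [jn jmin]] : exists j, near_optimal n j z /\
    forall i, near_optimal n i z -> (j <= i)%N.
  have H : exists j, `[< near_optimal n j z >].
    by have [j ?] := near_optimal_exists n z; exists j; exact/asboolP.
  exists (ex_minn H); case: ex_minnP => j /asboolP hj jmin; split=> //.
  by move=> i hi; apply: jmin; exact/asboolP.
exists j; split => // -[i /= ij /jmin]; by rewrite leqNgt ij.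
Qed.

Let sel_inj n i j z : sel n i z -> sel n j z -> i = j.
Proof.
move=> [i1 i2] [j1 j2]; case: (ltngtP i j) => // ij; exfalso.
- by apply: j2; exists i.
- by apply: i2; exists j.
Qed.

(** Near-optimality passes from the algebra to all measurable sets, since the algebra is dense for
    [Q z] and [m] simultaneously. *)
Let sel_optimal n j z B : sel n j z -> measurable B ->
  (nu z B <= nu z (A j) + eps n)%R.
Proof.
move=> [oj _] mB; apply/ler_addgt0Pr => e e0.
(* The error in [Q z] counts once and that in [m] is weighted by the absolute value of [q], so that
   together they amount to [e]. *)
have d0 : (0 < e / (1 + `|q|))%R by rewrite divr_gt0// ltr_pwDl.
have [i [i1 i2]] := generated_algebra_dense (Q z) m genG mB d0.
have mD : measurable (B `\` A i `|` A i `\` B).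
  by apply: measurableU; exact: measurableD.
apply: (le_trans (nu_perturb z mB (mA i))).
rewrite -addrA lerD//; first exact: oj.
have {}i1 : (fine (Q z (B `\` A i `|` A i `\` B)) <= e / (1 + `|q|))%R.
  by rewrite -lee_fin fineK ?fin_num_measure// ltW.
have {}i2 : (fine (m (B `\` A i `|` A i `\` B)) <= e / (1 + `|q|))%R.
  by rewrite -lee_fin fineK ?fin_num_measure// ltW.
apply: (le_trans (lerD i1 (ler_wpM2l (normr_ge0 q) i2))).
by rewrite -[X in (X + _ <= _)%R]mul1r -mulrDl mulrCA mulfV ?mulr1// gt_eqF// ltr_pwDl.
Qed.

(* The [z]-section is the limsup of the near-optimal sets chosen for [z]. *)
Let P : set (Z * T) :=
  \bigcap_N \bigcup_(n >= N) \bigcup_j (sel n j `*` A j).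

(** Borel-Cantelli: the bounds [eps n / e] are summable. *)
Let eps_summable e (F : (set T)^nat) : (0 < e)%R ->
  (forall n, measurable (F n)) ->
  (forall n, (e * fine (m (F n)) <= eps n)%R) -> m (lim_sup_set F) = 0.
Proof.
move=> e0 mF Fe; apply: lim_sup_set_cvg0 => //.
have ei0 : (0 <= e^-1)%R by rewrite invr_ge0 ltW.
apply: (@le_lt_trans _ _ (\sum_(n <oo) (e^-1 / (2 ^ n.+1)%:R)%:E)).
  apply: lee_nneseries => [//|n _]; rewrite -[leLHS]fineK ?fin_num_measure//.
  rewrite lee_fin -(ler_pM2l e0) (le_trans (Fe n))// /eps mulrA mulfV ?gt_eqF//.
exact: (le_lt_trans (epsilon_trick0 xpredT ei0) (ltry _)).
Qed.

(** The conditions on [C] compare measures, so no density is presupposed; they mean that the density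
    of [Q z] is at least [q + e], or at most [q - e], on [C]. The gap [e] turns near-optimality into
    measure bounds. *)
Lemma measurable_level_set : exists P : set (Z * T), measurable P /\
  forall z C e, measurable C -> (0 < e)%R ->
  ((forall B, measurable B -> B `<=` C -> (q + e)%:E * m B <= Q z B) ->
     m (C `\` xsection P z) = 0) /\
  ((forall B, measurable B -> B `<=` C -> Q z B <= (q - e)%:E * m B) ->
     m (C `&` xsection P z) = 0).
Proof.
exists P; split.
  apply: bigcapT_measurable => N; apply: bigcup_measurable => n _.
  by apply: bigcup_measurable => j _; exact: measurableX.
move=> z C e mC e0.
have [k selk] : exists k : nat -> nat, forall n, sel n (k n) z.
  by have [k kP] := choice (sel_exists ^~ z); exists k.
have PE y : xsection P z y <-> lim_sup_set (A \o k) y.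
  rewrite /xsection /= inE; split=> H N _; have [n Nn] := H N I.
    move=> [j _ [/= sj Aj]]; exists n => //=.
    by rewrite (sel_inj (selk n) sj).
  by move=> Akn; exists n => //; exists (k n).
have mP : measurable (xsection P z).
  rewrite (_ : xsection P z = lim_sup_set (A \o k)); last first.
    by apply/seteqP; split => y /PE.
  apply: bigcapT_measurable => N; apply: bigcup_measurable => n _.
  exact: mA.
have fineM r B : measurable B -> fine (r%:E * m B) = (r * fine (m B))%R.
  by move=> mB; rewrite -[m B]fineK ?fin_num_measure.
split=> H.
- apply: (@subset_measure0 _ _ _ _ _ (lim_sup_set (fun n => C `\` A (k n)))).
  + exact: measurableD.
  + apply: bigcapT_measurable => N; apply: bigcup_measurable => n _.
    exact: measurableD.
  (* A point of [C] outside the limsup is missed by all late [A (k n)], hence lies in the limsup of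
     the differences. *)
  + move=> y [Cy nPy] N _; apply: contrapT => nH; apply: nPy; apply/PE.
    move=> N' _; exists (maxn N N') => /=; first exact: leq_maxr.
    apply: contrapT => nA; apply: nH; exists (maxn N N') => //=.
    exact: leq_maxl.
  apply: (eps_summable e0) => n; first exact: measurableD.
  have mD : measurable (C `\` A (k n)) by exact: measurableD.
  (* Adding [C \ A (k n)] to [A (k n)] gains at least [e] times its [m]-measure, so this product is
     at most [eps n]. *)
  have /(sel_optimal (selk n)) : measurable (A (k n) `|` (C `\` A (k n))).
    exact: measurableU.
  rewrite nuU//; last by apply/disj_setPS => x [? []].
  rewrite lerD2l; apply: le_trans.
  have : (fine ((q + e)%:E * m (C `\` A (k n))) <= fine (Q z (C `\` A (k n))))%R.
    rewrite fine_le ?fin_num_measure// ?fin_numM ?fin_num_measure//.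
    by apply: H => // x [].
  by rewrite fineM// /nu; lra.
- rewrite (_ : C `&` xsection P z = lim_sup_set (fun n => C `&` A (k n))).
    apply: (eps_summable e0) => n; first exact: measurableI.
    have mI : measurable (C `&` A (k n)) by exact: measurableI.
    have mD : measurable (A (k n) `\` C) by exact: measurableD.
    (* Dually, removing from [A (k n)] its part in [C] gains at least [e] times the measure of that
       part. *)
    have := sel_optimal (selk n) mD.
    have {2}-> : A (k n) = (A (k n) `\` C) `|` (C `&` A (k n)).
      by rewrite [C `&` _]setIC setUC setUIDK.
    rewrite nuU//; last by apply/disj_setPS => x [[_ nCx] []].
    have : (fine (Q z (C `&` A (k n))) <= fine ((q - e)%:E * m (C `&` A (k n))))%R.
      rewrite fine_le ?fin_num_measure// ?fin_numM ?fin_num_measure//.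
      by apply: H => // x [].
    by rewrite fineM// /nu; lra.
  apply/seteqP; split=> [y [Cy /PE Py] N _|y Ly].
    by have [n Nn Any] := Py N I; exists n.
  split; first by have [n _ []] := Ly 0%N I.
  by apply/PE => N _; have [n Nn [_ Any]] := Ly N I; exists n.
Qed.

End level_set.

(** * Joint density recovered from the level sets *)

Section kernel_density.
Context d d' (Z : measurableType d) (T : measurableType d') (R : realType).
Variables (Q : Z -> {finite_measure set T -> \bar R}).
Variables (mu : {sigma_finite_measure set T -> \bar R}) (G : (set T)^nat).
Hypothesis genG : @measurable _ T = <<s range G >>.
Hypothesis mQ : forall B, measurable B -> measurable_fun [set: Z] (fun z => Q z B).
Hypothesis Q_mu : forall z B, measurable B -> mu B = 0 -> Q z B = 0.

(** Integrating a bound on [f] over subsets of [D] gives the comparison of measures that the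
    level-set property asks for, with [mu] cut down to [D]. *)
Let density_level z (f : T -> \bar R) (D : set T) (q e : R) (P : set T) :
  (0 <= q)%R -> (0 < e)%R -> measurable D -> measurable P ->
  (forall y, 0 <= f y) -> measurable_fun [set: T] f ->
  (forall A, measurable A -> Q z A = \int[mu]_(y in A) f y) ->
  (forall C e, measurable C -> (0 < e)%R ->
    ((forall B, measurable B -> B `<=` C -> (q + e)%:E * mu (B `&` D) <= Q z B) ->
      mu ((C `\` P) `&` D) = 0) /\
    ((forall B, measurable B -> B `<=` C -> Q z B <= (q - e)%:E * mu (B `&` D)) ->
      mu ((C `&` P) `&` D) = 0)) ->
  mu (D `&` [set y | (q + e)%:E <= f y] `\` P) = 0 /\
  mu (D `&` [set y | f y <= (q - e)%:E] `&` P) = 0.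
Proof.
move=> q0 e0 mD mP f0 mf Qf level.
have mC1 : measurable (D `&` [set y | (q + e)%:E <= f y]).
  apply: measurableI => //; rewrite -[X in measurable X]setTI.
  exact: emeasurable_fun_c_infty.
have mC2 : measurable (D `&` [set y | f y <= (q - e)%:E]).
  apply: measurableI => //; rewrite -[X in measurable X]setTI.
  exact: emeasurable_fun_infty_c.
have [lev1 _] := level _ _ mC1 e0; have [_ lev2] := level _ _ mC2 e0.
split.
- have <- := lev1 _; first by congr (mu _); apply/seteqP; split=> y /=; tauto.
  move=> B mB BC; have -> : B `&` D = B by apply/setIidPl => y /BC [].
  rewrite Qf// -integral_cst//; apply: ge0_le_integral => //.
  + by move=> y _; rewrite lee_fin addr_ge0// ltW.
  + exact: measurable_funTS.
  + by move=> y /BC [].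
- have <- := lev2 _; first by congr (mu _); apply/seteqP; split=> y /=; tauto.
  move=> B mB BC; have -> : B `&` D = B by apply/setIidPl => y /BC [].
  (* Monotonicity is applied to nonnegative integrands; a negative upper bound on [f] leaves only
     the empty set. *)
  have [qe0|qe0] := leP 0%R (q - e)%R.
    rewrite Qf// -integral_cst//; apply: ge0_le_integral => //.
    + exact: measurable_funTS.
    + by move=> y /BC [].
  have -> : B = set0.
    apply/seteqP; split => // y /BC [_ /= fy].
    by have := le_trans (f0 y) fy; rewrite lee_fin leNgt qe0.
  by rewrite !measure0 mule0.
Qed.

(** For fixed [z] the Radon-Nikodym theorem gives a density [f] without control on how it depends on
    [z]. The function [p] is built from the level sets alone, hence jointly measurable; [f] only
    serves to identify it almost everywhere. *)
Lemma kernel_radon_nikodym : exists p : Z * T -> \bar R,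
  [/\ forall zy, 0 <= p zy, measurable_fun [set: Z * T] p &
      forall z A, measurable A -> Q z A = \int[mu]_(y in A) p (z, y)].
Proof.
have [F TF /all_and2[mF muFoo]] := sigma_finiteT mu.
(* An index codes a level, the absolute value of a rational, and a piece of finite measure; an index
   coding no pair gets level 0 on the empty set. *)
pose q (n : nat) : R := 
  if (unpickle n : option (rat * nat)) is Some ri then `|ratr ri.1|%R else 0%R.
pose D (n : nat) : set T :=
  if (unpickle n : option (rat * nat)) is Some ri then F ri.2 else set0.
have q0 n : (0 <= q n)%R by rewrite /q; case: (unpickle n) => [ri|].
have mD n : measurable (D n) by rewrite /D; case: (unpickle n) => [ri|].
have muD n : mu (D n) < +oo.
  by rewrite /D; case: (unpickle n) => [ri|]; [exact: muFoo|rewrite measure0].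
have [P PP] := choice (fun n => measurable_level_set
  (mfrestr (mD n) (muD n)) genG mQ (q n)).
have mP n : measurable (P n) by case: (PP n).
pose g n (zy : Z * T) := (q n * \1_(P n `&` [set: Z] `*` D n) zy)%:E.
have mg n : measurable_fun [set: Z * T] (g n).
  apply/measurable_EFinP; apply: measurable_funM => //.
  apply: measurable_indic; apply: measurableI => //; exact: measurableX.
pose p zy := esups (g ^~ zy) 0%N.
have g_p n zy : g n zy <= p zy by apply: ereal_sup_ubound; exists n.
have g0 n zy : 0 <= g n zy by rewrite lee_fin mulr_ge0.
have p0 zy : 0 <= p zy by exact: le_trans (g0 0%N zy) (g_p _ _).
have mp : measurable_fun [set: Z * T] p by exact: measurable_fun_esups.
exists p; split => // z A mA.
have Qzmu : Q z `<< mu.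
  by apply/null_content_dominatesP => B mB; exact: Q_mu.
have [f [f0 ffin intf Qf]] := radon_nikodym_sigma_finite Qzmu.
have mf : measurable_fun [set: T] f by exact: measurable_int intf.
rewrite Qf//; apply: ge0_ae_eq_integral => //.
- exact: measurable_funTS.
- by apply: measurable_funTS; exact: measurableT_comp mp (pair1_measurable z).
have e0 k : (0 < k.+1%:R^-1 :> R)%R by rewrite invr_gt0.
have mPz n : measurable (xsection (P n) z) by exact: measurable_xsection.
have null n k : mu (D n `&` [set y | (q n + k.+1%:R^-1)%:E <= f y] `\`
    xsection (P n) z) = 0 /\
    mu (D n `&` [set y | f y <= (q n - k.+1%:R^-1)%:E] `&`
    xsection (P n) z) = 0.
  by apply: (@density_level z) => // C e mC ee0; have [_ /(_ z C e mC ee0)] := PP n.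
(* Here some level set contradicts [f] by a margin [1 / (k + 1)]; off this null set [p] and [f]
   agree. *)
pose N := \bigcup_n \bigcup_k
  ((D n `&` [set y | (q n + k.+1%:R^-1)%:E <= f y] `\` xsection (P n) z) `|`
   (D n `&` [set y | f y <= (q n - k.+1%:R^-1)%:E] `&` xsection (P n) z)).
have N0 : mu.-negligible N.
  apply: negligible_bigcup => n; apply: negligible_bigcup => k.
  have mC1 : measurable (D n `&` [set y | (q n + k.+1%:R^-1)%:E <= f y]).
    apply: measurableI => //; rewrite -[X in measurable X]setTI.
    exact: emeasurable_fun_c_infty.
  have mC2 : measurable (D n `&` [set y | f y <= (q n - k.+1%:R^-1)%:E]).
    apply: measurableI => //; rewrite -[X in measurable X]setTI.
    exact: emeasurable_fun_infty_c.
  have [n1 n2] := null n k; apply: negligibleU; apply/negligibleP => //.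
    exact: measurableD.
  exact: measurableI.
apply: negligibleS N0 => y /= /not_implyP [_ fNp]; apply: contrapT => nN.
apply: fNp; have [fr fE] : exists r : R, f y = r%:E.
  by exists (fine (f y)); rewrite fineK.
have fr0 : (0 <= fr)%R by rewrite -lee_fin -fE.
have [i _ Fiy] : (\bigcup_i F i) y by rewrite -TF.
apply/eqP; rewrite eq_le; apply/andP; split.
(* A rational level strictly between [p] and [f], on a piece containing [y], has [y] in its level
   set and so forces [p] up to it. *)
- rewrite leNgt; apply/negP => pf.
  have pE : p (z, y) = (fine (p (z, y)))%:E.
    by rewrite fineK// ge0_fin_numE// (lt_trans pf)// fE ltry.
  have [r] : exists r : rat, ratr r \in `]fine (p (z, y)), fr[.
    by apply: rat_in_itvoo; rewrite -lte_fin -pE -fE.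
  rewrite in_itv /= => /andP[pr rf].
  have r0 : (0 <= ratr r :> R)%R.
    by rewrite (le_trans _ (ltW pr))// fine_ge0.
  have [n qE DE] : exists2 n, q n = ratr r & D n = F i.
    by exists (pickle (r, i)); rewrite /q /D pickleK //= ger0_norm.
  have [k _ kr] : exists2 k, True & (k.+1%:R^-1 < fr - ratr r)%R.
    have rf0 : (0 < fr - ratr r)%R by rewrite subr_gt0.
    have [k _ /(_ _ (leqnn k))] := near_infty_natSinv_lt (PosNum rf0).
    by exists k.
  have Py : P n (z, y).
    apply: contrapT => nP; apply: nN; exists n => //; exists k => //; left.
    split; last by rewrite /xsection /= inE.
    split; first by rewrite DE.
    by rewrite /= fE lee_fin qE -lerBrDl ltW.
  have := g_p n (z, y); rewrite /g indicE mem_set; last by split => //; split => //=; rewrite DE.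
  by rewrite mulr1 qE pE lee_fin leNgt pr.
- apply: ge_ereal_sup => _ [n _ <-]; rewrite /g indicE.
  have [/set_mem[Py [_ /= Dy]]|_] := boolP (_ \in _); last by rewrite mulr0.
  (* A level above [f y] exceeds it by some [1 / (k + 1)], so its level set cannot contain [y]. *)
  rewrite mulr1 fE lee_fin leNgt; apply/negP => fq.
  have fq0 : (0 < q n - fr)%R by rewrite subr_gt0.
  have [k _ /(_ _ (leqnn k)) kq] := near_infty_natSinv_lt (PosNum fq0).
  apply: nN; exists n => //; exists k => //; right; split.
    by split => //=; rewrite fE lee_fin lerBrDr -lerBrDl ltW.
  by rewrite /xsection /= inE.
Qed.

End kernel_density.

(** * Borel structure of the state space and of its compactification *)

Lemma countable_range (T : pointedType) (S : set T) :
  countable S -> exists s : nat -> T, S `<=` range s.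
Proof.
move=> /countable_injP[f finj].
have H n : exists x : T, (exists2 y, S y & f y = n) -> S x /\ f x = n.
  have [[y Sy fy]|H] := pselect (exists2 y, S y & f y = n); first by exists y.
  by exists point.
have [s sP] := choice H; exists s => x Sx; exists (f x) => //.
have [Ss fs] : S (s (f x)) /\ f (s (f x)) = f x by apply: sP; exists x.
by apply: finj; rewrite ?inE.
Qed.

Section exhaustion.
Context (R : realType) (M : ptopologicalType).
Hypothesis M_lc : locally_compact [set: M].
Hypothesis M_sep : separable M.
Hypothesis M_metr : metrizable R M.

(** Balls with centres in a dense sequence and radii [1 / (k + 1)]. The open ones form a base; the
    closed ones supply the compact exhaustion. *)
Lemma countable_balls : exists B C : (set M)^nat,
  [/\ forall n, open (B n), forall n, closed (C n), forall n, B n `<=` C n &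
      forall x N, nbhs x N -> exists n, B n x /\ C n `<=` N].
Proof.
have [S Scnt Sdense] := M_sep; have [s Ss] := countable_range Scnt.
have [d [d0 dC dD dnbhs]] := M_metr.
have dxx x : d x x = 0%R by exact/d0.
have ball_nbhs x y (e : R) : (d x y < e)%R -> nbhs y [set z | (d x z < e)%R].
  move=> xye; rewrite dnbhs; exists (e - d x y)%R => /=; first by rewrite subr_gt0.
  by move=> z /= yz; have := dD x y z; move: yz; lra.
have open_ball x (e : R) : open [set y | (d x y < e)%R].
  by rewrite openE => y /= xy; exact: ball_nbhs.
have closed_ball x (e : R) : closed [set y | (d x y <= e)%R].
  rewrite -openC openE => y /= /negP; rewrite -ltNge => xy.
  rewrite /interior dnbhs; exists (d x y - e)%R => /=; first by rewrite subr_gt0.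
  move=> z /= yz; apply/negP; rewrite -ltNge.
  by have := dD x z y; have := dC y z; move: yz; lra.
pose c (n : nat) : M :=
  if (unpickle n : option (nat * nat)) is Some ik then s ik.1 else point.
pose r (n : nat) : R :=
  if (unpickle n : option (nat * nat)) is Some ik then ik.2.+1%:R^-1%R else 0%R.
exists (fun n => [set y | (d (c n) y < r n)%R]).
exists (fun n => [set y | (d (c n) y <= r n)%R]); split => //.
  by move=> n y /= /ltW.
move=> x N; rewrite dnbhs => -[e /= e0 eN].
have e20 : (0 < e / 2)%R by rewrite divr_gt0.
(* The centre will lie within one radius of [x], so the closed ball reaches at most two radii away
   from [x]. *)
have [k _ /(_ _ (leqnn k)) /= ke] := near_infty_natSinv_lt (PosNum e20).
have k0 : (0 < k.+1%:R^-1 :> R)%R by rewrite invr_gt0.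
have [y [/= xy Sy]] : [set y | (d x y < k.+1%:R^-1)%R] `&` S !=set0.
  by apply: Sdense => //; exists x; rewrite /= dxx.
have [i _ si] := Ss y Sy; exists (pickle (i, k)); split => /=.
  by rewrite /c /r pickleK /= si dC.
rewrite /c /r pickleK /= si => z /= yz; apply: eN => /=.
by have := dD x y z; move: xy yz ke; move: (k.+1%:R^-1)%R => q; lra.
Qed.

Lemma borel_countably_generated : exists G : (set M)^nat,
  @measurable _ (borel M) = <<s range G >>.
Proof.
have [B [C [oB _ BC BN]]] := countable_balls; exists B.
apply/seteqP; split.
  apply: smallest_sub; first exact: smallest_sigma_algebra.
  move=> O oO; have -> : O = \bigcup_n (if `[< B n `<=` O >] then B n else set0).
    apply/seteqP; split => [x Ox|x [n _]]; last first.
      by case: asboolP => [+ Bx|_ []]; apply.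
    have [n [Bx CO]] := BN x O (open_nbhs_nbhs (conj oO Ox)).
    exists n => //; case: asboolP => // H; exfalso; apply: H.
    exact: subset_trans (BC n) CO.
  apply: sigma_algebra_bigcup => n; case: ifP => _; last exact: sigma_algebra0.
  by apply: sub_sigma_algebra; exists n.
apply: sub_sigma_algebra2 => _ [n _ <-]; exact: oB.
Qed.

(** Finite unions of the closed balls that are compact and contained in [U]; local compactness
    provides such a ball around each point. Points must be interior to some [K n]: the path
    arguments rely on neighbourhoods, not merely on a cover. *)
Lemma open_exhaustion (U : set M) : open U -> exists K : (set M)^nat,
  [/\ forall n, compact (K n) /\ closed (K n), forall n, K n `<=` U,
      forall n m, (n <= m)%N -> K n `<=` K m &
      forall x, U x -> exists n, nbhs x (K n)].
Proof.
move=> oU; have [B [C [oB cC BC BN]]] := countable_balls.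
pose L n := if `[< compact (C n) /\ C n `<=` U >] then C n else set0.
have cL n : compact (L n) /\ closed (L n).
  rewrite /L; case: asboolP => [[]//|_]; split; first exact: compact0.
  exact: closed0.
exists (fun n => \big[setU/set0]_(i < n) L i); split.
- move=> n; split; first by apply: bigsetU_compact => i _; case: (cL i).
  by apply: closed_bigsetU => i _; case: (cL i).
- move=> n; rewrite -bigcup_mkord => x [i _]; rewrite /L.
  by case: asboolP => [[_ +] Cx|_ []]; apply.
- by move=> n m nm; exact: subset_bigsetU.
move=> x Ux; have [N] := @M_lc x I; rewrite withinET => nN [cN clN].
have [n [Bx CN]] := BN x (N `&` U) (filterI nN (open_nbhs_nbhs (conj oU Ux))).
exists n.+1; rewrite big_ord_recr /=; apply: (@filterS _ _ _ (B n)); last first.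
  by apply: open_nbhs_nbhs; split.
move=> y By; right; rewrite /L; case: asboolP => [_|H]; first exact: BC.
exfalso; apply: H; split; last by move=> z /CN [].
by apply: (@subclosed_compact _ (C n) N) => // z /CN [].
Qed.

End exhaustion.

Section borel_compactification.
Context (M : ptopologicalType).
Local Notation MD := (compactification M).

Lemma measurable_Some : measurable_fun [set: borel M] (Some : borel M -> borel MD).
Proof.
refine (@measurability _ _ (borel M) (borel MD) setT Some (@open MD) erefl _) => _ [N oN <-]; rewrite setTI.
apply: sub_sigma_algebra.
apply: open_comp => // x _; exact: one_point_compactification_some_continuous.
Qed.

(** [Some] is injective and maps open sets to open sets; complements are taken within the open image
    of [M]. *)
Lemma measurable_image_Some (A : set (borel M)) :
  measurable A -> measurable (Some @` A : set (borel MD)).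
Proof.
have mopen (O : set M) : open O -> measurable (Some @` O : set (borel MD)).
  move=> oO; apply: sub_sigma_algebra.
  exact: one_point_compactification_open_some.
move: A; apply: smallest_sub; last exact: mopen.
split => [|A mA|F mF].
- by rewrite image_set0.
- have -> : Some @` ([set: M] `\` A) = (Some @` [set: M]) `\` (Some @` A).
    apply/seteqP; split => [_ [x [_ nAx] <-]|_ [[x _ <-] nA]].
      by split; [exists x|move=> [y Ay [yx]]; apply: nAx; rewrite -yx].
    by exists x => //; split => // Ax; apply: nA; exists x.
  by apply: measurableD => //; apply: mopen; exact: openT.
- by rewrite image_bigcup; exact: bigcup_measurable.
Qed.

Lemma measurable_Delta : measurable ([set Delta] : set (borel MD)).
Proof.
have -> : [set Delta] = ~` (Some @` [set: M]).
  apply/seteqP; split => [_ -> [x _ //]|[x|//] nx]; exfalso.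
  by apply: nx; exists x.
by apply: measurableC; exact: measurable_image_Some.
Qed.

(** The singleton of [Delta] is Borel, so the value there is unconstrained. *)
Lemma measurable_fun_compactification d (T : measurableType d) (f : MD -> T) :
  measurable_fun [set: borel M] (f \o Some) ->
  measurable_fun [set: borel MD] f.
Proof.
move=> mf _ B mB; rewrite setTI.
have -> : f @^-1` B =
    Some @` ((f \o Some) @^-1` B) `|` (if `[< B (f Delta) >] then [set Delta] else set0).
  apply/seteqP; split => [[x|] Bx|y [[x Bx <-]//|]].
  - by left; exists x.
  - by right; case: asboolP.
  - by case: asboolP => // ? ->.
apply: measurableU.
  by apply: measurable_image_Some; rewrite -[X in measurable X]setTI; exact: mf.
by case: ifP => _ //; exact: measurable_Delta.
Qed.

End borel_compactification.

(** * Borel dependence of the law on the starting point *)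

Lemma ge0_integral_mrestr d (T : measurableType d) (R : realType)
    (m : {measure set T -> \bar R}) (E : set T) (mE : measurable E) (f : T -> \bar R) :
  (forall x, 0 <= f x) -> measurable_fun [set: T] f ->
  \int[mrestr m mE]_x f x = \int[m]_(x in E) f x.
Proof.
move=> f0 mf; rewrite (@ge0_negligible_integral _ _ _ _ setT (~` E)) //.
- rewrite setTD setCK; apply: eq_measure_integral => A mA AE.
  by rewrite /= /mrestr (setIidl AE).
- exact: measurableC.
- by rewrite /= /mrestr setICl measure0.
Qed.

Section law_measurable.
Context (R : realType) (M : ptopologicalType) (X : process R M).
Hypothesis hX : is_hunt X.
Local Notation MD := (compactification M).
Local Notation Omega := (sample X).

Let mcoord t (A : set (borel MD)) : 0 <= t -> measurable A ->
  measurable (coord X t @^-1` A).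
Proof.
by move=> t0 mA; rewrite -[_ @^-1` _]setTI; exact: (coord_measurable hX).
Qed.

Lemma natural_filtration_measurable t : natural_filtration t `<=` @measurable _ Omega.
Proof.
apply: smallest_sub; first exact: sigma_algebra_measurable.
by move=> _ [s [A [/andP[s0 _] mA ->]]]; exact: mcoord.
Qed.

Let measurable_law (E : set Omega) :=
  measurable_fun [set: borel M] (fun x : borel M => law X (Some x) E).

Let measurable_lawT : measurable_law setT.
Proof.
rewrite /measurable_law (_ : (fun x => _) = cst 1); first exact: measurable_cst.
by apply/funext => x; rewrite probability_setT.
Qed.

Let measurable_lawD E F : F `<=` E -> measurable E -> measurable F ->
  measurable_law E -> measurable_law F -> measurable_law (E `\` F).
Proof.
move=> FE mE mF lE lF.
rewrite /measurable_law (_ : (fun x => _) =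
    (fun x => law X (Some x) E - law X (Some x) F)).
  exact: emeasurable_funB.
apply/funext => x; rewrite measureD//; last by rewrite ltey_eq fin_num_measure.
by rewrite (setIidr FE).
Qed.

(** The axioms speak of Borel sets of [M] only. If [A] contains [Delta], the event is [E] minus the
    paths that are in [M] but outside [A] at time [t]. *)
Let measurable_law_split (E : set Omega) t : measurable E -> 0 <= t ->
  measurable_law E ->
  (forall A : set (borel M), measurable A ->
    measurable_law (E `&` coord X t @^-1` (Some @` A))) ->
  forall A : set (borel MD), measurable A -> measurable_law (E `&` coord X t @^-1` A).
Proof.
move=> mE t0 lE lEA A mA.
have mA' : measurable (Some @^-1` A : set (borel M)).
  by rewrite -[_ @^-1` _]setTI; exact: measurable_Some.
have mT : measurable (Some @` [set: M] : set (borel MD)).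
  exact: (@measurable_image_Some _ setT).
have [AD|nAD] := pselect (A Delta); last first.
  have -> : A = Some @` (Some @^-1` A).
    by apply/seteqP; split => [[x|] //= Ax|_ [x Ax <-]//]; exists x.
  exact: lEA.
have -> : E `&` coord X t @^-1` A = E `\`
   ((E `&` coord X t @^-1` (Some @` [set: M])) `\`
    (E `&` coord X t @^-1` (Some @` (Some @^-1` A)))).
  apply/seteqP; split => [w [Ew Aw]|w [Ew /= H]]; split => //=.
    move=> [[_ [x _ xw]] H]; apply: H; split => //.
    by exists x => //=; rewrite xw.
  case xw : (coord X t w) => [x|//]; apply: contrapT => nA; apply: H; split.
    by split => //; exists x.
  by move=> [_ [y Ay]]; rewrite xw => -[yx]; apply: nA; rewrite -yx.
apply: measurable_lawD => //.
- by move=> w [[]].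
- apply: measurableD; apply: measurableI => //; apply: mcoord => //.
  exact: measurable_image_Some.
- apply: measurable_lawD => //.
  + by move=> w [Ew [x Ax xw]]; split => //; exists x.
  + by apply: measurableI => //; exact: mcoord.
  + apply: measurableI => //; apply: mcoord => //; exact: measurable_image_Some.
  + exact: (lEA setT).
  + exact: lEA.
Qed.

Let transition_measurable (s : R) (A : set (borel M)) : (0 <= s)%R ->
  measurable A ->
  measurable_fun [set: borel MD]
    (fun y : borel MD => law X y (coord X s%:E @^-1` (Some @` A))).
Proof.
by move=> s0 mA; apply: measurable_fun_compactification; exact: (law_measurable hX).
Qed.

(** By the Markov property the probability is the integral of a transition function against the law
    of the position at time [t] restricted to [E], a kernel in [x] by assumption. *)
Let markov_step (E : set Omega) (t s : R) : (0 <= t)%R -> (0 <= s)%R ->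
  natural_filtration t%:E E ->
  (forall A : set (borel MD), measurable A ->
     measurable_law (E `&` coord X t%:E @^-1` A)) ->
  forall A : set (borel MD), measurable A ->
    measurable_law (E `&` coord X (t + s)%:E @^-1` A).
Proof.
move=> t0 s0 nE H.
have mE := natural_filtration_measurable nE.
have lE : measurable_law E by have := H setT measurableT; rewrite preimage_setT setIT.
apply: measurable_law_split => //; first by rewrite lee_fin addr_ge0.
move=> A mA.
have mX : measurable_fun [set: Omega] (coord X t%:E : Omega -> borel MD).
  by apply: (coord_measurable hX); rewrite lee_fin.
pose g (y : borel MD) := law X y (coord X s%:E @^-1` (Some @` A)).
have mg : measurable_fun [set: borel MD] g by exact: transition_measurable.
pose Q (x : borel M) : {measure set (borel MD) -> \bar R} :=
  pushforward (mrestr (law X (Some x)) mE) (coord X t%:E : Omega -> borel MD).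
rewrite /measurable_law (_ : (fun x => _) = (fun x => \int[Q mX x]_y g y)); last first.
  apply/funext => x; rewrite (law_markov hX x t0 s0 mA nE).
  rewrite ge0_integral_pushforward//= preimage_setT ge0_integral_mrestr//.
  exact: measurableT_comp mg mX.
apply: measurable_fun_integral_kernel => // B mB.
have -> : (Q mX) ^~ B = fun x => law X (Some x) (E `&` coord X t%:E @^-1` B).
  by apply/funext => x; rewrite setIC.
exact: H.
Qed.

Let cylinder (l : seq (R * set MD)) : set Omega :=
  \big[setI/setT]_(p <- l) (coord X p.1%:E @^-1` p.2).

Let valid (p : R * set MD) := (0 <= p.1)%R /\ measurable (p.2 : set (borel MD)).

(* Times are listed in decreasing order, so that the Markov property is applied
   at the head of the tail. *)
Let cylinder_sorted (t : R) A l :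
  (forall p, p \in (t, A) :: l -> valid p) ->
  sorted (fun p q => (q.1 <= p.1)%R) ((t, A) :: l) ->
  natural_filtration t%:E (cylinder ((t, A) :: l)) /\
  forall B : set (borel MD), measurable B ->
    measurable_law (cylinder ((t, A) :: l) `&` coord X t%:E @^-1` B).
Proof.
have nI t' (E F : set Omega) : natural_filtration t' E -> natural_filtration t' F ->
    natural_filtration t' (E `&` F).
  move=> nE nF.
  exact: (@measurableI _ (g_sigma_algebraType (coord_events t' : set (set Omega)))).
have nX (t' : R) (B : set (borel MD)) : (0 <= t')%R -> measurable B ->
    natural_filtration t'%:E (coord X t'%:E @^-1` B).
  move=> t0 mB; apply: sub_sigma_algebra; exists t'%:E, B.
  by rewrite lee_fin t0 lexx.
elim: l t A => [|[s B] l IH] t A lv sl.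
  have [/= t0 mA] := lv _ (mem_head _ _).
  rewrite /cylinder big_seq1; split; first exact: nX.
  move=> B mB; rewrite -preimage_setI.
  have mAB : measurable (A `&` B : set (borel MD)) by exact: measurableI.
  rewrite -[_ @^-1` _]setTI; apply: measurable_law_split => //.
  by move=> C mC; rewrite setTI; exact: (law_measurable hX).
have [/= t0 mA] := lv _ (mem_head _ _).
have {}lv p : p \in (s, B) :: l -> valid p.
  by move=> pl; apply: lv; rewrite in_cons pl orbT.
have [/= s0 mB] := lv _ (mem_head _ _).
move: sl => /= /andP[st sl]; have [nE lE] := IH s B lv sl.
set E := cylinder _ in nE lE.
have -> : cylinder [:: (t, A), (s, B) & l] = coord X t%:E @^-1` A `&` E.
  by rewrite /cylinder big_cons.
split.
  apply: nI; first exact: nX.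
  apply: sub_sigma_algebra2 nE => _ [u [C [/andP[u0 us] mC ->]]].
  exists u, C; split => //; rewrite u0 /=; apply: le_trans us _.
  by rewrite lee_fin.
move=> C mC; rewrite [_ `&` E]setIC -setIA -preimage_setI.
(* [s] is the latest time of the tail; a Markov step of length [t - s] leads from it to [t]. *)
have -> : t = (s + (t - s))%R by rewrite addrC subrK.
apply: markov_step => //; first by rewrite subr_ge0.
exact: measurableI.
Qed.

Let measurable_law_cylinder l : (forall p, p \in l -> valid p) ->
  measurable_law (cylinder l).
Proof.
move=> lv; pose r (p q : R * set MD) := (q.1 <= p.1)%R.
have -> : cylinder l = cylinder (sort r l).
  by apply: perm_big; rewrite perm_sym perm_sort.
have slv p : p \in sort r l -> valid p by rewrite mem_sort; exact: lv.
have : sorted r (sort r l) by apply: sort_sorted => p q; exact: le_total.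
move: slv; case: (sort r l) => [|[t A] l'] slv sl.
  by rewrite /cylinder big_nil.
have [_ /(_ setT measurableT)] := cylinder_sorted slv sl.
by rewrite preimage_setT setIT.
Qed.

Lemma law_measurable_natural (E : set Omega) : natural_filtration +oo E ->
  measurable_fun [set: borel M] (fun x : borel M => law X (Some x) E).
Proof.
move=> nE; pose G := [set cylinder l | l in [set l | forall p, p \in l -> valid p]].
have mG F : <<s G >> F -> measurable F.
  move: F; apply: smallest_sub; first exact: sigma_algebra_measurable.
  move=> _ [l lv <-]; rewrite /cylinder big_seq; apply: bigsetI_measurable => p pl.
  by have [p0 mp] := lv p pl; apply: mcoord => //; rewrite lee_fin.
have {}nE : <<s G >> E.
  move: E nE; apply: smallest_sub; first exact: smallest_sigma_algebra.
  move=> _ [s [A [/andP[s0 _] mA ->]]]; case: s s0 => [s s0|_|//].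
    apply: sub_sigma_algebra; exists [:: (s, A)]; last first.
      by rewrite /cylinder big_seq1.
    by move=> p; rewrite inE => /eqP -> ; split => //=; rewrite -lee_fin.
  (* Cylinders use real times only. At time [+oo] the path sits at [Delta], so the event is
     everything or empty. *)
  have XD w : coord X +oo w = Delta by apply: (coord_cemetery hX); rewrite leey.
  have [AD|nAD] := pselect (A Delta).
    have -> : coord X +oo @^-1` A = setT by apply/seteqP; split => // w _ /=; rewrite XD.
    exact: (@measurableT _ (g_sigma_algebraType G)).
  have -> : coord X +oo @^-1` A = set0 by apply/seteqP; split => // w /=; rewrite XD.
  exact: sigma_algebra0.
move: E nE; apply: (@dynkin_induction _ (g_sigma_algebraType G)) => //.
- move=> _ _ [l lv <-] [l' lv' <-]; exists (l ++ l').
    by move=> p; rewrite mem_cat => /orP[/lv|/lv'].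
  by rewrite /cylinder big_cat.
- by move=> _ [l lv <-]; exact: measurable_law_cylinder.
- by move=> S mS lS; rewrite -setTD; apply: measurable_lawD => //; exact: mG.
- move=> F mF tF lF.
  rewrite (_ : (fun x => _) = fun x => \sum_(n <oo) law X (Some x) (F n)).
    exact: ge0_emeasurable_sum.
  apply/funext => x; rewrite measure_bigcup//; first by apply: eq_eseriesl => n; apply/esym; rewrite in_setT.
  by move=> n _; apply: mG; exact: mF.
Qed.

End law_measurable.

(** * The exit time and its announcing sequence *)

(** Since [K] is compact and closed, its complement together with [Delta] is a neighbourhood of
    [Delta]. *)
Lemma closed_image_Some (M : ptopologicalType) (K : set M) :
  compact K -> closed K -> closed (Some @` K : set (compactification M)).
Proof.
move=> cK clK; rewrite -openC openE => -[x|] nKx.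
  have nx : ~ K x by move=> Kx; apply: nKx; exists x.
  have : nbhs (Some x : compactification M) (Some @` (~` K)).
    apply: one_point_compactification_some_nbhs; apply: open_nbhs_nbhs; split => //.
    exact: closed_openC.
  by apply: filterS => _ [y nKy <-] [z Kz [zy]]; apply: nKy; rewrite -zy.
exists K => // _ [[y nKy <-]|->] [z Kz //] [zy].
by apply: nKy; rewrite -zy.
Qed.

Section exit_time.
Context (R : realType) (M : ptopologicalType) (X : process R M).
Hypothesis hX : is_hunt X.
Local Notation MD := (compactification M).
Local Notation Omega := (sample X).

Lemma coord_near_right (w : Omega) (t : R) (V : set MD) : (0 <= t)%R ->
  nbhs (coord X t%:E w) V ->
  exists2 e : R, (0 < e)%R & forall s : R, (t < s < t + e)%R -> V (coord X s%:E w).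
Proof.
move=> t0 nV; have /= [e /= e0 H] := @coord_right_continuous _ _ _ hX w _ t0 _ nV.
exists e => // s /andP[ts st]; apply: H => //=.
by rewrite ltr_norml; apply/andP; split; lra.
Qed.

(** [exit_time U] is, by conversion, the hitting time of the complement of the image of [U], so the
    lemmas below apply to it. *)
Definition hitting_time (F : set MD) (w : Omega) : \bar R :=
  ereal_inf [set t%:E | t in [set t : R | (0 <= t)%R /\ F (coord X t%:E w)]].

Lemma hitting_time_ge0 F w : 0 <= hitting_time F w.
Proof. by apply: le_ereal_inf_tmp => _ [t [t0 _] <-]; rewrite lee_fin. Qed.

Lemma hitting_time_le F w (t : R) : (0 <= t)%R -> F (coord X t%:E w) ->
  hitting_time F w <= t%:E.
Proof. by move=> t0 Ft; apply: ereal_inf_lbound; exists t. Qed.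

Lemma hitting_timeS F G w : F `<=` G -> hitting_time G w <= hitting_time F w.
Proof.
by move=> FG; apply: ereal_inf_le_tmp => _ [t [t0 /FG Gt] <-]; exists t.
Qed.

(** By right-continuity a path visiting an open set stays there for a while, hence is there at a
    rational time. *)
Lemma hitting_time_lt_open (F : set MD) w (t : R) : open F ->
  hitting_time F w < t%:E <->
  exists q : rat, (0 <= ratr q :> R)%R /\ (ratr q < t)%R /\ F (coord X (ratr q)%:E w).
Proof.
move=> oF; split=> [/ereal_inf_lt [_ [s [s0 Fs] <-]]|[q [q0 [qt Fq]]]]; last first.
  by apply: (le_lt_trans (hitting_time_le q0 Fq)); rewrite lte_fin.
rewrite lte_fin => st.
have [e e0 He] := coord_near_right s0 (open_nbhs_nbhs (conj oF Fs)).
have : (s < Num.min t (s + e))%R by rewrite lt_min st ltrDl.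
move=> /rat_in_itvoo [q]; rewrite in_itv /= lt_min => /and3P[sq qt qe].
exists q; split; first by rewrite (le_trans s0)// ltW.
by split => //; apply: He; rewrite sq.
Qed.

Lemma hitting_time_lt_measurable (F : set MD) (t : R) : open F ->
  natural_filtration t%:E [set w : Omega | hitting_time F w < t%:E].
Proof.
move=> oF; pose G (q : rat) : set Omega :=
  if ((0 <= ratr q :> R) && (ratr q < t))%R then coord X (ratr q)%:E @^-1` F else set0.
have -> : [set w : Omega | hitting_time F w < t%:E] = \bigcup_q G q.
  apply/seteqP; split => [w /= /(hitting_time_lt_open _ _ oF)[q [q0 [qt Fq]]]|w [q _]].
    by exists q => //; rewrite /G q0 qt.
  rewrite /G; case: ifP => // /andP[q0 qt] Fq.
  by apply/hitting_time_lt_open => //; exists q.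
apply: (@bigcupT_measurable_rat _
  (g_sigma_algebraType (coord_events t%:E : set (set Omega)))) => q.
rewrite /G; case: ifP => [/andP[q0 qt]|_]; last exact: sigma_algebra0.
apply: sub_sigma_algebra; exists (ratr q)%:E, F; split => //.
  by rewrite !lee_fin q0 ltW.
exact: sub_sigma_algebra.
Qed.

Lemma natural_filtrationS (s t : \bar R) : s <= t ->
  natural_filtration s `<=` (natural_filtration t : set (set Omega)).
Proof.
move=> st; apply: sub_sigma_algebra2 => _ [u [A [/andP[u0 us] mA ->]]].
by exists u, A; split => //; rewrite u0 (le_trans us).
Qed.

Lemma natural_filtration_filtration (t : \bar R) :
  natural_filtration t `<=` (filtration t : set (set Omega)).
Proof.
move=> E nE nu _; exists E, set0; split => //.
- exact: sigma_algebra0.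
- rewrite /init_law; under eq_integral do rewrite measure0.
  exact: integral0.
- by rewrite setDv setU0.
Qed.

(** The event that the time is at most [t] belongs to the filtration at every [s > t];
    right-continuity of the filtration brings it down to [t]. *)
Lemma stopping_time_hitting_time (F : set MD) : open F ->
  stopping_time (hitting_time F).
Proof.
move=> oF; split=> [w|t t0]; first exact: hitting_time_ge0.
rewrite -(filtration_right_continuous hX t0) => s /= ts.
apply: natural_filtration_filtration.
(* These times decrease from [s] to [t] without reaching [t]. *)
pose r (k : nat) : R := (t + (s - t) / k.+1%:R)%R.
have rt k : (t < r k)%R by rewrite /r ltrDl divr_gt0// subr_gt0.
have rs k : (r k <= s)%R.
  rewrite /r -lerBrDl ler_pdivrMr// ler_peMr ?subr_ge0 ?(ltW ts)//.
  by rewrite ler1n.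
have -> : [set w : Omega | hitting_time F w <= t%:E] =
    \bigcap_k [set w | hitting_time F w < (r k)%:E].
  apply/seteqP; split => [w /= h k _|w h] /=.
    by apply: (le_lt_trans h); rewrite lte_fin.
  apply/lee_addgt0Pr => e e0.
  have e1 : (0 < e / (s - t))%R by rewrite divr_gt0// subr_gt0.
  have [k _ /(_ _ (leqnn k)) /= ke] := near_infty_natSinv_lt (PosNum e1).
  apply: (le_trans (ltW (h k I))); rewrite -EFinD lee_fin /r lerD2l.
  by rewrite mulrC -ler_pdivlMr ?subr_gt0// ltW.
apply: (@bigcapT_measurable _
  (g_sigma_algebraType (coord_events s%:E : set (set Omega)))) => k.
apply: (@natural_filtrationS (r k)%:E); first by rewrite lee_fin.
exact: hitting_time_lt_measurable.
Qed.

Section exhaustion_of_U.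
Variables (U : set M) (K : (set M)^nat).
Hypothesis cK : forall n, compact (K n) /\ closed (K n).
Hypothesis KU : forall n, K n `<=` U.
Hypothesis K_nd : forall n m, (n <= m)%N -> K n `<=` K m.
Hypothesis UK : forall x, U x -> exists n, nbhs x (K n).

Let hit n := hitting_time (~` (Some @` K n) : set MD).

Let openCK n : open (~` (Some @` K n) : set MD).
Proof. by apply: closed_openC; have [? ?] := cK n; exact: closed_image_Some. Qed.

Definition announcing_time (w : Omega) : \bar R :=
  ereal_sup (range (fun n => hitting_time (~` (Some @` K n)) w)).

Let hit_nd w : nondecreasing_seq (hit ^~ w).
Proof.
move=> n m nm; apply: hitting_timeS; apply: subsetC.
by move=> _ [x Kx <-]; exists x => //; exact: K_nd Kx.
Qed.

(** Were the path interior to [K n] at that time, right-continuity would keep it in [K n] a little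
    longer and the hitting time would be later. *)
Let coord_hit n w x : hit n w < +oo -> coord X (hit n w) w = Some x ->
  ~ nbhs x (K n).
Proof.
move=> hoo hx nK; have := hitting_time_ge0 (~` (Some @` K n)) w.
rewrite -/(hit n w).
have hE : hit n w = (fine (hit n w))%:E.
  by rewrite fineK// ge0_fin_numE//; exact: hitting_time_ge0.
set r := fine _ in hE; rewrite hE in hx *; rewrite lee_fin => r0.
have nV : nbhs (coord X r%:E w) (Some @` K n).
  by rewrite hx; exact: one_point_compactification_some_nbhs.
have [e e0 He] := coord_near_right r0 nV.
have : (r + e)%:E <= hit n w.
  apply: le_ereal_inf_tmp => _ [s [s0 ns] <-]; rewrite lee_fin leNgt; apply/negP => se.
  have rs : (r <= s)%R by rewrite -lee_fin -hE; exact: hitting_time_le.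
  move: rs; rewrite le_eqVlt => /predU1P[rs|rs]; apply: ns.
    by rewrite -rs; exact: nbhs_singleton.
  by apply: He; rewrite rs.
by rewrite hE lee_fin; lra.
Qed.

Lemma announcing_time_le w : announcing_time w <= exit_time U w.
Proof.
apply: ge_ereal_sup => _ [n _ <-]; apply: hitting_timeS; apply: subsetC.
by move=> _ [x Kx <-]; exists x => //; exact: KU Kx.
Qed.

(* The hitting times of the complements of the [K n] announce the exit time, by
   quasi-left-continuity. *)
Lemma exit_time_announced (nu : probability (borel MD) R) :
  exists N : set Omega, [/\ natural_filtration +oo N, init_law nu N = 0 &
    forall w, ~ N w -> exit_time U w = announcing_time w].
Proof.
have st n : stopping_time (hit n) by exact: stopping_time_hitting_time.
have [N [nN N0 NP]] := law_quasi_left_continuous hX nu st hit_nd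
  (fun w => ereal_nondecreasing_cvgn (@hit_nd w)).
exists N; split => // w nNw; apply/eqP; rewrite eq_le announcing_time_le andbT.
have [->|] := eqVneq (announcing_time w) +oo; first by rewrite leey.
rewrite -ltey => soo; have cvg := NP w nNw soo.
have s0 : 0 <= announcing_time w.
  apply: (le_trans (hitting_time_ge0 (~` (Some @` K 0%N)) w)).
  by apply: ereal_sup_ubound; exists 0%N.
have sE : announcing_time w = (fine (announcing_time w))%:E.
  by rewrite fineK// ge0_fin_numE.
rewrite sE; apply: hitting_time_le; first exact: fine_ge0.
(* If the limit position were in [U], it would be interior to some [K m], and so would the positions
   at late hitting times, against [coord_hit]. *)
rewrite -sE => -[x Ux xs]; have [m nKm] := UK Ux.
have : nbhs (coord X (announcing_time w) w) (Some @` (K m)°).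
  rewrite -xs; apply: one_point_compactification_some_nbhs.
  by apply: nbhs_interior.
move=> /cvg [n0 _ Hn0].
have [y /= Ky hy] := Hn0 (maxn n0 m) (leq_maxl _ _).
apply: (@coord_hit (maxn n0 m) w y).
- by apply: le_lt_trans soo; apply: ereal_sup_ubound; exists (maxn n0 m).
- by rewrite hy.
- by apply: filterS Ky; apply: K_nd; exact: leq_maxr.
Qed.

Local Notation Omega0 := (g_sigma_algebraType (coord_events +oo : set (set Omega))).

(** Separating [t] from a hitting time by a rational gives countably many rectangles, whose path
    sides lie in the uncompleted sigma-algebra. *)
Lemma announcing_time_gt_measurable :
  measurable ([set tw : R * Omega0 | tw.1%:E < announcing_time tw.2]).
Proof.
pose G n (q : rat) : set (R * Omega0) :=
  [set t : R | (t < ratr q)%R] `*` [set w : Omega0 | ~ (hit n w < (ratr q)%:E)].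
have -> : [set tw : R * Omega0 | tw.1%:E < announcing_time tw.2] =
    \bigcup_n \bigcup_q G n q.
  apply/seteqP; split => [[t w] /= /ereal_sup_gt [_ [n _ <-] th]|[t w] [n _ [q _ [/= tq /negP qh]]]].
    exists n => //.
    have : exists2 r : R, (t < r)%R & r%:E <= hit n w.
      move: th; rewrite -/(hit n w); case: (hit n w) => [h| |//].
        by rewrite lte_fin => th; exists h.
      by move=> _; exists (t + 1)%R; rewrite ?ltrDl// leey.
    move=> [r /rat_in_itvoo[q]]; rewrite in_itv /= => /andP[tq qr] rh.
    exists q => //; split => //=; apply/negP; rewrite -leNgt.
    by apply: le_trans rh; rewrite lee_fin ltW.
  move: qh; rewrite -leNgt => qh; apply: (@lt_le_trans _ _ (ratr q)%:E).
    by rewrite lte_fin.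
  by apply: (le_trans qh); apply: ereal_sup_ubound; exists n.
apply: bigcupT_measurable => n; apply: bigcupT_measurable_rat => q.
apply: measurableX.
  rewrite (_ : [set t : R | (t < ratr q)%R] = `]-oo, (ratr q : R)[%classic).
    exact: measurable_itv.
  by apply/seteqP; split => t /=; rewrite in_itv.
apply: (@measurableC _ Omega0 [set w | hit n w < (ratr q)%:E]).
apply: (@natural_filtrationS (ratr q)%:E); first by rewrite leey.
exact: hitting_time_lt_measurable.
Qed.

End exhaustion_of_U.

End exit_time.

(** * The killed kernel *)

Section joint_measurability.
Context (R : realType) (M : ptopologicalType) (X : process R M).
Hypothesis hX : is_hunt X.
Hypothesis M_lc : locally_compact [set: M].
Hypothesis M_sep : separable M.
Hypothesis M_metr : metrizable R M.
Local Notation MD := (compactification M).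
Local Notation Omega := (sample X).
Local Notation Omega0 := (g_sigma_algebraType (coord_events +oo : set (set Omega))).

Let grid (n k : nat) : R := (k%:R / n.+1%:R)%R.

Let grid_ge0 n k : (0 <= grid n k)%R.
Proof. by rewrite /grid divr_ge0. Qed.

(* Right-continuity recovers [X_t] from its values at the grid points just
   after [t]. *)
Let near_event (n : nat) (B : set MD) : set (R * Omega0) :=
  \bigcup_k (`[grid n k, grid n k.+1[%classic `*`
             (coord X (grid n k.+1)%:E @^-1` B : set Omega0)).

(** Exactly one half-open cell contains [t]; its right end is strictly later than [t], as
    right-continuity requires. *)
Let near_eventP n B (t : R) w : (0 <= t)%R -> exists s : R,
  [/\ (t < s)%R, (s <= t + n.+1%:R^-1)%R &
      near_event n B (t, w) <-> B (coord X s%:E w)].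
Proof.
move=> t0; have tn0 : (0 <= t * n.+1%:R)%R by rewrite mulr_ge0.
have /andP[tk kt] := truncn_itv tn0; set k := Num.truncn _ in tk kt.
have gk : (grid n k <= t)%R by rewrite /grid ler_pdivrMr.
have gk1 : (t < grid n k.+1)%R by rewrite /grid ltr_pdivlMr.
exists (grid n k.+1); split => //.
  rewrite /grid -natr1 mulrDl mul1r lerD2r; exact: gk.
split=> [[j _ [/=]]|Bt]; last first.
  by exists k => //; split => //=; rewrite in_itv /= gk.
rewrite in_itv /= => /andP[gj gj1] Bj.
suff <- : j = k by [].
apply/eqP; rewrite eqn_leq; apply/andP; split.
  have := le_lt_trans gj gk1; rewrite /grid ltr_pM2r ?invr_gt0//.
  by rewrite ltr_nat ltnS.
have := le_lt_trans gk gj1; rewrite /grid ltr_pM2r ?invr_gt0//.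
by rewrite ltr_nat ltnS.
Qed.

Let measurable_near_event n (B : set (borel MD)) : measurable B ->
  measurable (near_event n B).
Proof.
move=> mB; apply: bigcupT_measurable => k; apply: measurableX.
  exact: measurable_itv.
apply: sub_sigma_algebra; exists (grid n k.+1)%:E, B; split => //.
by rewrite lee_fin grid_ge0 leey.
Qed.

Let position (A : set M) : set (R * Omega0) :=
  [set tw | (0 <= tw.1)%R /\ (Some @` A) (coord X tw.1%:E tw.2)].

(** The path is in [N] at time [t] iff, for some [m], it is in [K m] at all sufficiently fine grid
    points after [t]: one direction uses interior points of [K m], the other that [K m] has closed
    image. *)
Let measurable_position_open (N : set M) : open N -> measurable (position N).
Proof.
move=> oN; have [K [cK KN K_nd NK]] := open_exhaustion M_lc M_sep M_metr oN.
have clK m : closed (Some @` K m : set MD).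
  by have [? ?] := cK m; exact: closed_image_Some.
have -> : position N = (`[0%R, +oo[%classic `*` [set: Omega0]) `&`
    \bigcup_m \bigcup_n0 \bigcap_(n in [set n | (n0 <= n)%N]) near_event n (Some @` K m).
  apply/seteqP; split => [[t w] [/= t0 [x Nx xt]]|[t w] [[/= + _]]].
    split; first by split => //=; rewrite in_itv /= t0.
    have [m nKm] := NK x Nx.
    have nV : nbhs (coord X t%:E w) (Some @` K m : set MD).
      by rewrite -xt; exact: one_point_compactification_some_nbhs.
    have [e e0 He] := coord_near_right hX t0 nV.
    have [n0 _ Hn0] := near_infty_natSinv_lt (PosNum e0).
    exists m => //; exists n0 => // n /= n0n.
    have [s [ts st sP]] := near_eventP n (Some @` K m) w t0.
    apply/sP; apply: He; rewrite ts /=; apply: (le_lt_trans st).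
    by rewrite ltrD2l; exact: Hn0.
  rewrite in_itv /= andbT => t0 [m _ [n0 _ H]]; split => //=.
  apply: contrapT => nN.
  have nV : nbhs (coord X t%:E w) (~` (Some @` K m) : set MD).
    apply: open_nbhs_nbhs; split; first exact: closed_openC.
    by move=> [x Kx xt]; apply: nN; exists x => //; exact: KN Kx.
  have [e e0 He] := coord_near_right hX t0 nV.
  have [n1 _ Hn1] := near_infty_natSinv_lt (PosNum e0).
  pose n := maxn n0 n1.
  have [s [ts st sP]] := near_eventP n (Some @` K m) w t0.
  have := H n (leq_maxl _ _); move/sP; apply: He.
  rewrite ts /=; apply: (le_lt_trans st).
  by rewrite ltrD2l; apply: Hn1; exact: leq_maxr.
apply: measurableI; first by apply: measurableX => //; exact: measurable_itv.
apply: bigcupT_measurable => m; apply: bigcupT_measurable => n0.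
apply: bigcap_measurable; first by exists n0 => /=.
move=> n _; apply: measurable_near_event.
rewrite -[X in measurable X]setCK; apply: measurableC.
by apply: sub_sigma_algebra; exact: closed_openC.
Qed.

(** Complements are relative to the event of being in [M] at a nonnegative time. *)
Lemma measurable_position (A : set (borel M)) : measurable A ->
  measurable ([set tw | (0 <= tw.1)%R /\ (Some @` A) (coord X tw.1%:E tw.2)]
    : set (R * Omega0)).
Proof.
move: A; apply: smallest_sub; last exact: measurable_position_open.
split=> [|A mA|F mF].
- rewrite (_ : mkset _ = set0)//; by apply/seteqP; split => // tw [_ [x []]].
- rewrite (_ : mkset _ = position [set: M] `\` position A).
    by apply: measurableD => //; apply: measurable_position_open; exact: openT.
  apply/seteqP; split => [[t w] [/= t0 [x [_ nAx] xt]]|].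
    split; first by split => //; exists x.
    by move=> [_ [y Ay]]; rewrite /= -xt => -[yx]; apply: nAx; rewrite -yx.
  move=> [t w] [[/= t0 [x _ xt]] H]; split => //=; exists x => //; split => // Ax.
  by apply: H; split => //=; exists x.
- rewrite (_ : mkset _ = \bigcup_n position (F n)).
    by apply: bigcup_measurable => n _; exact: mF.
  apply/seteqP; split => [[t w] [/= t0 [x [n _ Fx] xt]]|[t w] [n _ [/= t0 [x Fx xt]]]].
    by exists n => //; split => //=; exists x.
  by split => //=; exists x => //; exists n.
Qed.

End joint_measurability.

(** * The killed kernel as a measurable family of finite measures *)

Section killed_kernel.
Context (R : realType) (M : ptopologicalType) (X : process R M).
Hypothesis hX : is_hunt X.
Hypothesis M_lc : locally_compact [set: M].
Hypothesis M_sep : separable M.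
Hypothesis M_metr : metrizable R M.
Local Notation MD := (compactification M).
Local Notation Omega := (sample X).
Local Notation Omega0 := (g_sigma_algebraType (coord_events +oo : set (set Omega))).

(** Turns the null sets that [exit_time_announced] gives for a point mass into null sets of the law
    started at [x]. *)
Lemma init_law_dirac (x : M) (N : set Omega) : natural_filtration +oo N ->
  init_law (dirac (Some x : borel MD) : probability (borel MD) R) N =
  law X (Some x) N.
Proof.
move=> nN; have mf : measurable_fun [set: borel MD] (fun y => law X y N).
  by apply: measurable_fun_compactification; exact: (law_measurable_natural hX nN).
by rewrite /init_law integral_dirac// diracT mul1e.
Qed.

Lemma measurable_sample_id :
  measurable_fun [set: Omega] (fun w : Omega => w : Omega0).
Proof.
by move=> _ A mA; rewrite setTI; exact: (natural_filtration_measurable hX mA).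
Qed.

Lemma measurable_law_xsection (S : set ((R * borel M) * Omega0)) : measurable S ->
  measurable_fun [set: R * borel M]
    (fun z => law X (Some z.2) (xsection S z)).
Proof.
move=> mS.
(* Pushing forward along the identity restricts the laws to the sigma-algebra of the paths, where
   they form a kernel. *)
pose k0 (z : R * borel M) : {measure set Omega0 -> \bar R} :=
  pushforward (law X (Some z.2)) (fun w : Omega => w : Omega0).
have mk A : measurable A ->
    measurable_fun [set: R * borel M] (k0 measurable_sample_id ^~ A).
  move=> mA; apply: (measurableT_comp (law_measurable_natural hX mA)).
  exact: measurable_snd.
pose k1 : R.-ker (R * borel M) ~> Omega0 :=
  HB.pack (k0 measurable_sample_id) (isKernel.Build _ _ _ _ _ _ mk).
have uub : measure_fam_uub k1.
  (* The total mass is 1 and the uniform bound has to be strict. *)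
  exists 2%R => z; apply: (@le_lt_trans _ _ 1); last by rewrite lte_fin ltr1n.
  exact: (@probability_le1 _ _ _ (law X (Some z.2)) setT measurableT).
pose k : R.-fker (R * borel M) ~> Omega0 :=
  HB.pack (k0 measurable_sample_id) k1 (Kernel_isFinite.Build _ _ _ _ _ k1 uub).
exact: (@measurable_fun_xsection_finite_kernel _ _ _ _ _ k S (mem_set mS)).
Qed.

Section announced.
Variables (U : set M) (K : (set M)^nat).
Hypothesis cK : forall n, compact (K n) /\ closed (K n).
Hypothesis KU : forall n, K n `<=` U.
Hypothesis K_nd : forall n m, (n <= m)%N -> K n `<=` K m.
Hypothesis UK : forall x, U x -> exists n, nbhs x (K n).

Let alive (A : set M) : set (R * Omega0) :=
  [set tw | (0 <= tw.1)%R /\ (Some @` A) (coord X tw.1%:E tw.2)] `&`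
  [set tw | tw.1%:E < announcing_time K tw.2].

Let measurable_alive (A : set (borel M)) : measurable A -> measurable (alive A).
Proof.
move=> mA; apply: measurableI; first exact: measurable_position.
exact: announcing_time_gt_measurable.
Qed.

Let measurable_alive_section (A : set (borel M)) (t : R) : measurable A ->
  @measurable _ Omega0 [set w | alive A (t, w)].
Proof.
move=> mA; have := measurable_xsection t (measurable_alive mA).
rewrite (_ : xsection _ _ = [set w | alive A (t, w)])//.
by apply/seteqP; split => w; rewrite /xsection /= inE.
Qed.

(** The killed event lies between the event defined with the announcing time and its union with a
    null set, so the outer measure takes the same value on it. *)
Lemma killed_kernelE (t : R) (x : M) (A : set (borel M)) :
  (0 <= t)%R -> measurable A ->
  killed_kernel X U t x A = law X (Some x) [set w | alive A (t, w)].
Proof.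
move=> t0 mA.
have mE : measurable ([set w | alive A (t, w)] : set Omega).
  by apply: (natural_filtration_measurable hX); exact: measurable_alive_section.
have [N [nN N0 NE]] := exit_time_announced hX cK KU K_nd UK
  (dirac (Some x : borel MD) : probability (borel MD) R).
have mN : measurable N by exact: (natural_filtration_measurable hX) nN.
have {}N0 : law X (Some x) N = 0 by rewrite -init_law_dirac.
rewrite /killed_kernel; apply/eqP; rewrite eq_le; apply/andP; split.
- rewrite -[leRHS](measureU0 mE mN N0) -measurable_mu_extE//; last first.
    exact: measurableU.
  apply: le_mu_ext => w /= [Aw tw].
  have [Nw|nNw] := pselect (N w); first by right.
  by left; split => //=; rewrite -NE.
- rewrite -measurable_mu_extE//; apply: le_mu_ext => w [[_ Aw] tw]; split => //.
  exact: lt_le_trans tw (announcing_time_le KU w).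
Qed.

(** Extending by zero off [D] makes [Q] a family over the whole parameter space, as the density
    theorem requires. Each measure is the image, under the position at time [t], of the law
    restricted to surviving paths. *)
Lemma killed_kernel_measure (D : set (R * borel M)) (W : set (borel M)) :
  measurable D -> measurable W -> D `<=` [set z | (0 <= z.1)%R] ->
  exists Q : R * borel M -> {finite_measure set (borel M) -> \bar R},
  [/\ forall A, measurable A -> measurable_fun [set: R * borel M] (fun z => Q z A),
      forall z A, D z -> measurable A ->
        Q z A = killed_kernel X U z.1 z.2 (A `&` W) &
      forall z A, ~ D z -> measurable A -> Q z A = 0].
Proof.
move=> mD mW D0.
pose S A : set ((R * borel M) * Omega0) :=
  (D `*` [set: Omega0]) `&` ((fun zw => (zw.1.1, zw.2)) @^-1` alive (A `&` W)).
have mS A : measurable A -> measurable (S A).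
  move=> mA; apply: measurableI; first exact: measurableX.
  rewrite -[X in measurable X]setTI.
  have mf : measurable_fun [set: (R * borel M) * Omega0]
      (fun zw => (zw.1.1, zw.2) : R * Omega0).
    apply: measurable_fun_pair; last exact: measurable_snd.
    exact: measurableT_comp measurable_fst measurable_fst.
  apply: (mf measurableT); apply: measurable_alive.
  exact: measurableI.
have mSz A z : measurable A -> measurable (xsection (S A) z : set Omega).
  move=> mA; apply: (natural_filtration_measurable hX).
  exact: (measurable_xsection z (mS A mA)).
have H z : exists m : {finite_measure set (borel M) -> \bar R},
    forall A, measurable A -> m A = law X (Some z.2) (xsection (S A) z).
  (* The cut-off time and the default [point] only make [f] total and measurable: on the section the
     time is nonnegative and the position lies in [M]. *)
  pose f (w : Omega) : borel M :=
    if coord X (Num.max 0 z.1)%:E w is Some y then y else point.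
  have mf : measurable_fun [set: Omega] f.
    pose r (y : borel MD) : borel M := if y is Some y' then y' else point.
    apply: (@measurableT_comp _ _ _ _ _ _ r).
      by apply: measurable_fun_compactification; exact: measurable_id.
    by apply: (coord_measurable hX); rewrite lee_fin le_max lexx.
  pose m0 : {measure set (borel M) -> \bar R} :=
    pushforward (mrestr (law X (Some z.2)) (mSz setT z measurableT)) f.
  have m0E A : measurable A -> m0 mf A = law X (Some z.2) (xsection (S A) z).
    move=> mA; congr (law X _ _); apply/seteqP; split => w.
      rewrite /xsection /= !inE => -[Afw [[Dz _] [[/= z0 [y [_ Wy] yw]] tw]]].
      split => //; split => //=; split => //; exists y => //; split => //.
      by move: Afw; rewrite /f max_r// -yw.
    rewrite /xsection /= !inE => -[[Dz _] [[/= z0 [y [Ay Wy] yw]] tw]].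
    split; first by rewrite /f max_r// -yw.
    by split => //; split => //=; split => //; exists y.
  have oo : m0 mf setT < +oo.
    rewrite m0E//; apply: (@le_lt_trans _ _ 1); last exact: ltry.
    exact: (probability_le1 _ (mSz setT z measurableT)).
  exists (mfrestr measurableT oo) => A mA; rewrite -m0E//.
  by rewrite /= /mfrestr /mrestr setIT.
have [Q QE] := choice H; exists Q; split.
- move=> A mA; under eq_fun do rewrite QE//.
  by apply: measurable_law_xsection; exact: mS.
- move=> z A Dz mA; rewrite QE// killed_kernelE//; last 2 first.
  + exact: D0.
  + exact: measurableI.
  congr (law X _ _); apply/seteqP; split => w; rewrite /xsection /= inE.
    by move=> [].
  by move=> h; split.
- move=> z A nDz mA; rewrite QE//.
  rewrite (_ : xsection _ _ = set0) ?measure0//.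
  by apply/seteqP; split => // w; rewrite /xsection /= inE => -[[]].
Qed.

End announced.

End killed_kernel.

(** * Truncation by the upper bound, and the equivalence *)

Lemma integral_mine_dominated d (T : measurableType d) (R : realType)
    (mu : {measure set T -> \bar R}) (W : set T) (f h : T -> \bar R) :
  measurable W -> (forall y, W y -> 0 <= f y) -> (forall y, W y -> 0 <= h y) ->
  measurable_fun W f -> measurable_fun W h ->
  (forall A, measurable A -> A `<=` W ->
     \int[mu]_(y in A) f y <= \int[mu]_(y in A) h y) ->
  forall A, measurable A -> A `<=` W ->
    \int[mu]_(y in A) f y = \int[mu]_(y in A) Order.min (f y) (h y).
Proof.
move=> mW f0 h0 mf mh fh A mA AW.
have mfh : measurable_fun W (fun y => Order.min (f y) (h y)) by exact: measurable_mine.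
have fh0 y : W y -> 0 <= Order.min (f y) (h y) by move=> Wy; rewrite le_min f0 ?h0.
have mAS B g : B `<=` A -> measurable_fun W g -> measurable_fun B (g : T -> \bar R).
  by move=> BA; apply: measurable_funS => //; exact: subset_trans AW.
apply/eqP; rewrite eq_le; apply/andP; split; last first.
  apply: ge0_le_integral => //; try exact: mAS.
    by move=> y /AW; exact: fh0.
  by move=> y _; rewrite ge_min lexx.
(* On the first piece the minimum is [f]; on the second it is [h], and domination applies to that
   piece. *)
pose A1 := A `&` [set y | f y <= h y]; pose A2 := A `&` [set y | h y < f y].
have mA1 : measurable A1 by apply: measurable_lee => //; exact: mAS.
have mA2 : measurable A2 by apply: measurable_lte => //; exact: mAS.
have A1A : A1 `<=` A by exact: subIsetl.
have A2A : A2 `<=` A by exact: subIsetl.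
have AE : A = A1 `|` A2.
  rewrite -setIUr; apply/esym/setIidPl => y _ /=.
  by case: (leP (f y) (h y)) => ?; [left|right].
have dA : [disjoint A1 & A2].
  by apply/disj_setPS => y [[_ /= yle] [_ /=]]; rewrite ltNge yle.
rewrite AE !ge0_integral_setU//; try by rewrite -AE; try (exact: mAS); move=> y /AW; auto.
apply: leeD.
  rewrite (eq_integral (fun y => Order.min (f y) (h y)))// => y.
  by rewrite inE => -[_ /= yle]; rewrite min_l.
rewrite [leRHS](eq_integral h); first by apply: fh => //; exact: subset_trans AW.
by move=> y; rewrite inE => -[_ /= /ltW yle]; rewrite min_r.
Qed.

Theorem proposition5p6 (R : realType) (M : ptopologicalType)
    (M_lc : locally_compact [set: M]) (M_sep : separable M)
    (M_metr : metrizable R M)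
    (mu : {sigma_finite_measure set (borel M) -> \bar R})
    (X : hunt_process R M)
    (I : set (R)) (I_ge0 : I `<=` [set t : R | (0 <= t)%R])
    (mI : measurable I)
    (V W : set (borel M)) (mV : measurable V) (mW : measurable W)
    (H : R -> M -> M -> \bar R)
    (H_ge0 : forall t x y, I t -> V x -> W y -> 0 <= H t x y)
    (mH : measurable_fun (I `*` (V `*` W))
            (fun z : R * (borel M * borel M) =>
               H z.1 z.2.1 z.2.2))
    (U : set M) (U_open : open U) (U_neq0 : U !=set0) :
  (forall (t : R) (x : M) (A : set (borel M)),
     I t -> V x -> measurable A -> A `<=` W ->
     killed_kernel X U t x A <= \int[mu]_(y in A) H t x y)
  <->
  (exists p : R -> M -> M -> \bar R,
     [/\ forall t x y, I t -> V x -> W y -> 0 <= p t x y,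
         measurable_fun (I `*` (V `*` W))
           (fun z : R * (borel M * borel M) =>
              p z.1 z.2.1 z.2.2) &
         forall (t : R) (x : M), I t -> V x ->
           (forall A : set (borel M), measurable A -> A `<=` W ->
              killed_kernel X U t x A = \int[mu]_(y in A) p t x y) /\
           (forall y, W y -> p t x y <= H t x y) ]).
Proof.
have mIVW : measurable (I `*` (V `*` W) : set (R * (borel M * borel M))).
  by do 2 apply: measurableX => //.
have section (f : R -> M -> M -> \bar R) t x : I t -> V x ->
    measurable_fun (I `*` (V `*` W))
      (fun z : R * (borel M * borel M) => f z.1 z.2.1 z.2.2) ->
    measurable_fun W (fun y : borel M => f t x y).
  move=> It Vx mf.
  apply: (@measurable_comp _ _ _ _ _ _ _ _ W
    (fun y => (t, (x, y)) : R * (borel M * borel M)) mIVW _ mf).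
    by move=> _ [y Wy <-].
  apply: measurable_funTS.
  exact: (measurableT_comp (pair1_measurable t) (pair1_measurable x)).
split; last first.
  move=> [p [p0 mp pP]] t x A It Vx mA AW; have [-> // pH] := pP t x It Vx.
  apply: ge0_le_integral => //.
  - by move=> y /AW; exact: p0.
  - by apply: measurable_funS mW AW _; exact: section mp.
  - by apply: measurable_funS mW AW _; exact: section mH.
  - by move=> y /AW; exact: pH.
move=> killed_le.
have [K [cK KU K_nd UK]] := open_exhaustion M_lc M_sep M_metr U_open.
have [G genG] := borel_countably_generated M_sep M_metr.
have mIV : measurable (I `*` V : set (R * borel M)) by exact: measurableX.
have IV0 : I `*` V `<=` [set z : R * borel M | (0 <= z.1)%R].
  by move=> z [/I_ge0].
have [Q [mQ QE Q0]] := killed_kernel_measure (hunt_process_axioms X)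
  M_lc M_sep M_metr cK KU K_nd UK mIV mW IV0.
(* The bound in (1) is an integral over a null set, whence absolute continuity; off [I] times [V]
   the measure vanishes. *)
have Q_mu z A : measurable A -> mu A = 0 -> Q z A = 0.
  move=> mA muA; have [Dz|/Q0->//] := pselect ((I `*` V) z).
  have mAW : measurable (A `&` W) by exact: measurableI.
  have AW : A `&` W `<=` W by exact: subIsetr.
  case: (Dz) => It Vx.
  apply/eqP; rewrite eq_le measure_ge0 andbT QE//; apply: (le_trans (killed_le _ _ _ It Vx mAW AW)).
  rewrite null_set_integral//.
    by apply: measurable_funS mW AW _; exact: section mH.
  by apply: subset_measure0 muA => //; exact: subIsetl.
have [q [q0 mq Qq]] := kernel_radon_nikodym genG mQ Q_mu.
have mq' : measurable_fun (I `*` (V `*` W))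
    (fun z : R * (borel M * borel M) => q ((z.1, z.2.1), z.2.2)).
  apply: measurable_funTS; apply: (measurableT_comp mq).
  apply: measurable_fun_pair; last exact: measurableT_comp measurable_snd measurable_snd.
  apply: measurable_fun_pair; first exact: measurable_fst.
  exact: measurableT_comp measurable_fst measurable_snd.
exists (fun t x y => Order.min (q ((t, x), y)) (H t x y)); split.
- by move=> t x y It Vx Wy; rewrite le_min q0 H_ge0.
- exact: measurable_mine.
- move=> t x It Vx; split => [A mA AW|y _]; last by rewrite ge_min lexx orbT.
  have qE B : measurable B -> B `<=` W ->
      killed_kernel X U t x B = \int[mu]_(y in B) q ((t, x), y).
    by move=> mB BW; rewrite -Qq// QE// (setIidl BW).
  rewrite qE//; apply: (@integral_mine_dominated _ _ _ mu W) => //.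
  + by move=> y Wy; exact: H_ge0.
  + exact: (section (fun t x y => q ((t, x), y))).
  + exact: section mH.
  + by move=> B mB BW; rewrite -qE//; exact: killed_le.
Qed.
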